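(* Let $T$ be a continuous bundle RDS on $\mathcal{E}$ over $(\Omega,\mathcal{F},\mathbf{P},\vartheta)$. Let $\Phi=\{f_n\}_{n=1}^{\infty}$ be a subadditive sequence of functions on $\mathcal{E}$ such that $f_1\in \mathbf{L}_{\mathcal{E}}^1(\Omega,\mathcal{C}(X))$ and each $f_n$ is measurable in $\omega$ and continuous in $x$. Then $\pi_T(\Phi)=-\infty$ if and only if $\Phi^*(\mu)=-\infty$ for all $\mu\in\mathcal{M}_{\mathbf{P}}^1(\mathcal{E},T)$.
   Context: **Bundle RDS.** $(\Omega,\mathcal{F},\mathbf{P})$ is a probability space with an invertible $\mathbf{P}$-preserving transformation $\vartheta$; $\mathcal{F}$ is complete, countably generated and separates points. $(X,d)$ is a compact metric space with Borel $\sigma$-algebra $\mathcal{B}$. $\mathcal{E}\subset\Omega\times X$ is measurable with respect to $\mathcal{F}\times\mathcal{B}$ and its fibers $\mathcal{E}_\omega=\{x\in X:(\omega,x)\in\mathcal{E}\}$ are compact. A continuous bundle random dynamical system (RDS) $T$ on $\mathcal{E}$ over $(\Omega,\mathcal{F},\mathbf{P},\vartheta)$ is generated by maps $T_\omega:\mathcal{E}_\omega\to\mathcal{E}_{\vartheta\omega}$, with iterates $T_\omega^n=T_{\vartheta^{n-1}\omega}\cdots T_{\vartheta\omega}T_\omega$ ($n\ge 1$) and $T_\omega^0=\mathrm{id}$, such that $(\omega,x)\mapsto T_\omega x$ is measurable and $x\mapsto T_\omega x$ is continuous for $\mathbf{P}$-almost all $\omega$. The skew product is $\Theta:\mathcal{E}\to\mathcal{E}$,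 $\Theta(\omega,x)=(\vartheta\omega,T_\omega x)$. **Measures.** $\mathcal{P}_{\mathbf{P}}(\mathcal{E})$ is the set of probability measures $\mu$ on $\Omega\times X$ with marginal $\mathbf{P}$ on $\Omega$ and $\mu(\mathcal{E})=1$. $\mathcal{M}_{\mathbf{P}}^1(\mathcal{E},T)$ is the set of $\Theta$-invariant $\mu\in\mathcal{P}_{\mathbf{P}}(\mathcal{E})$. **Function space and subadditivity.** $\mathbf{L}_{\mathcal{E}}^1(\Omega,\mathcal{C}(X))$ is the space of functions $f$ on $\mathcal{E}$, measurable in $(\omega,x)$ and continuous in $x\in\mathcal{E}_\omega$, with $\|f\|=\int\sup_{x\in\mathcal{E}_\omega}|f(\omega,x)|\,d\mathbf{P}(\omega)<\infty$, where $f,g$ are identified if $\|f-g\|=0$. A sequence $\Phi=\{f_n\}_{n\ge1}$ of functions on $\mathcal{E}$, each measurable in $\omega$ and continuous in $x$ (these are then measurable in $(\omega,x)$), is subadditive if $f_{n+m}(\omega,x)\le f_n(\omega,x)+f_m(\Theta^n(\omega,x))$ for all $(\omega,x)\in\mathcal{E}$ and $m,n\in\mathbb{N}$. For $\mu\in\mathcal{M}_{\mathbf{P}}^1(\mathcal{E},T)$, $\Phi^*(\mu)=\lim_{n\to\infty}\frac1n\int f_n\,d\mu\in[-\infty,\infty)$ (the limit exists by subadditivity). **Topological pressure.** For $n\in\mathbb{N}$, $d_n^\omega(x,y)=\max_{0\le k<n}d(T_\omega^kx,T_\omega^ky)$ for $x,y\in\mathcal{E}_\omega$. For $\epsilon>0$,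 $F\subset\mathcal{E}_\omega$ is $(\omega,\epsilon,n)$-separated if $d_n^\omega(x,y)>\epsilon$ for all distinct $x,y\in F$. Put $$\pi_T(\Phi)(\omega,\epsilon,n)=\sup\Big\{\sum_{x\in F}\exp(f_n(\omega,x)):F\text{ is an }(\omega,\epsilon,n)\text{-separated subset of }\mathcal{E}_\omega\Big\},$$ which is measurable in $\omega$, and $$\pi_T(\Phi)(\epsilon)=\limsup_{n\to\infty}\frac1n\int\log\pi_T(\Phi)(\omega,\epsilon,n)\,d\mathbf{P}(\omega),\qquad \pi_T(\Phi)=\lim_{\epsilon\to0}\pi_T(\Phi)(\epsilon)=\sup_{\epsilon>0}\pi_T(\Phi)(\epsilon).$$ *)

(* Defs.v *)
From HB Require Import structures.
From mathcomp Require Import all_boot all_order all_algebra.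
From mathcomp Require Import all_classical all_reals all_analysis.

Set Implicit Arguments.
Unset Strict Implicit.
Unset Printing Implicit Defensive.

Import Order.TTheory GRing.Theory Num.Theory.
Import numFieldNormedType.Exports.

Local Open Scope classical_set_scope.
Local Open Scope ring_scope.

(* [measurableType] requires a base point, which [metricType] does not have. *)
#[short(type="pointedMetricType")]
HB.structure Definition PointedMetric (K : numDomainType) :=
  {X of Pointed X & Metric K X}.

Notation borel X := (g_sigma_algebraType (@open X)).

Section BaseSystem.
Context (R : realType) (d : measure_display) (Omega : measurableType d).
Variables (P : probability Omega R) (theta : Omega -> Omega).

(* Completeness and literal countable generation are essentially incompatible
   for a diffuse measure; as usual, countable generation is understood modulo
   null sets.  A literally countably generated sigma-algebra satisfies this
   with B := A. *)
Definition countably_generated_mod0 : Prop :=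
  exists G : set (set Omega),
    [/\ countable G, G `<=` measurable &
        forall A, measurable A ->
          exists B, <<s G >> B /\ P.-negligible (A `+` B)].

Definition separates_points : Prop :=
  forall w w' : Omega, w <> w' -> exists A, [/\ measurable A, A w & ~ A w'].

Definition invertible_transformation : Prop :=
  exists theta' : Omega -> Omega,
    [/\ measurable_fun setT theta, measurable_fun setT theta',
        cancel theta theta' & cancel theta' theta].

Definition preserves_measure : Prop :=
  forall A, measurable A -> P (theta @^-1` A) = P A.

Record base_system : Prop := BaseSystem {
  base_complete : measure_is_complete P;
  base_countably_generated : countably_generated_mod0;
  base_separates_points : separates_points;
  base_invertible : invertible_transformation;
  base_preserves : preserves_measure }.

End BaseSystem.

Section BundleRDS.
Context (R : realType) (d : measure_display) (Omega : measurableType d).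
Context (X : pointedMetricType R).
Variables (P : probability Omega R) (theta : Omega -> Omega).
(* [T] and the functions [f] below are total; only their values over [E] are
   ever constrained or used. *)
Variables (E : set (Omega * borel X)) (T : Omega -> X -> X).

Definition fiber (w : Omega) : set X := xsection E w.

Record bundle_RDS : Prop := BundleRDS {
  bundle_measurable : measurable E;
  bundle_compact : forall w, compact (fiber w);
  bundle_maps : forall w x, fiber w x -> fiber (theta w) (T w x);
  bundle_map_measurable :
    measurable_fun E (fun p : Omega * borel X => T p.1 p.2 : borel X);
  bundle_map_continuous :
    {ae P, forall w, {within fiber w, continuous (T w)}} }.

Fixpoint T_iter (n : nat) (w : Omega) (x : X) : X :=
  if n is m.+1 then T (iter m theta w) (T_iter m w x) else x.

Definition skew_product (p : Omega * borel X) : Omega * borel X :=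
  (theta p.1, T p.1 p.2).

(* The preimage is cut down to [E] because the skew product is a map of [E]. *)
Record invariant_measure (mu : probability (Omega * borel X)%type R) : Prop :=
  InvariantMeasure {
  invariant_marginal : forall A, measurable A -> mu (A `*` setT) = P A;
  invariant_support : mu E = 1%E;
  invariant_skew : forall A, measurable A ->
    mu (E `&` skew_product @^-1` A) = mu (E `&` A) }.

(* "measurable in w" is rendered by joint measurability on [E]: over fibers
   that vary with [w], the former alone does not imply the latter. *)
Definition measurable_continuous (g : Omega * borel X -> R) : Prop :=
  measurable_fun E g /\
  forall w, {within fiber w, continuous (fun x : X => g (w, x))}.

(* The maximum with 0 makes the supremum over an empty fiber equal to 0. *)
Definition L1_norm (g : Omega * borel X -> R) : \bar R :=
  (\int[P]_w maxe 0 (ereal_sup [set `|g (w, x)|%:E | x in fiber w]))%E.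

Definition L1_continuous (g : Omega * borel X -> R) : Prop :=
  measurable_continuous g /\ (L1_norm g < +oo)%E.

(* A sequence indexed by the positive integers: [f 0] is never used. *)
Variable f : nat -> Omega * borel X -> R.

Definition subadditive_sequence : Prop :=
  forall n m, (0 < n)%N -> (0 < m)%N ->
    forall p, E p -> f (n + m)%N p <= f n p + f m (iter n skew_product p).

Definition Phi_star (mu : probability (Omega * borel X)%type R) : \bar R :=
  limn (fun n => (n%:R^-1)%:E * \int[mu]_(p in E) (f n p)%:E)%E.

Definition bowen_dist (w : Omega) (n : nat) (x y : X) : R :=
  \big[Num.max/0]_(k < n) mdist (T_iter k w x) (T_iter k w y).

Definition bowen_separated (w : Omega) (e : R) (n : nat) (F : set X) : Prop :=
  F `<=` fiber w /\
  forall x y, F x -> F y -> x <> y -> e < bowen_dist w n x y.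

(* [\esum] is needed because separated sets may be infinite for the negligible
   [w] where some iterate of [T] is discontinuous. *)
Definition pressure_fiber (w : Omega) (e : R) (n : nat) : \bar R :=
  ereal_sup [set (\esum_(x in F) (expR (f n (w, x)))%:E)%E
            | F in bowen_separated w e n].

Definition pressure_scale (e : R) : \bar R :=
  limn_esup (fun n =>
    (n%:R^-1)%:E * \int[P]_w lne (pressure_fiber w e n))%E.

Definition pressure : \bar R := lim (pressure_scale e @[e --> 0^'+]).

End BundleRDS.

(* Main.v *)
Require Import Defs.
From HB Require Import structures.
From mathcomp Require Import all_boot all_order all_algebra.
From mathcomp Require Import all_classical all_reals all_analysis.
From mathcomp Require Import measurable_realfun ring lra.

Set Implicit Arguments.
Unset Strict Implicit.
Unset Printing Implicit Defensive.

Import Order.TTheory GRing.Theory Num.Theory.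
Import numFieldNormedType.Exports.

Local Open Scope classical_set_scope.
Local Open Scope ring_scope.

(** Let [a] be the fiberwise supremum of the absolute value of [f 1] and [S_n a]
its Birkhoff sums along [theta] ([step_bound], [orbit_bound]).  Subadditivity
gives [f n <= S_n a], so the functions [h_n = S_n a - f n] are nonnegative,
superadditive and continuous on fibers ([deficit]).  Let [m_n] be the infimum of
[h_n] over the fiber ([min_deficit]).

Two points that follow the same itinerary through a cover of [X] by [M] sets of
diameter at most [e] are never separated by more than [e], so a set separated up
to time [n] has at most [M ^ n] points.  Hence the logarithm of the fiberwise
pressure sum lies between [S_n a - m_n] and [S_n a - m_n + n log M]
([log_pressure_ge], [log_pressure_le]): entropy contributes a bounded rate, and
the pressure is [-oo] exactly when the means of [m_n / n] tend to [+oo]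
([pressure_eqNy]; the contrary is [recurrent_deficit]).

If these means tend to [+oo], then so do the integrals of [h_n / n] for every
invariant measure, because [h_n >= m_n] and [S_n a] has mean [n] times that of
[a] ([Phi_star_eqNy]).  Conversely, suppose that the mean of [m_N] is at most
[N C] for infinitely many [N].  An invariant [mu] for which [h_n] has integral at
most [n C] for every [n] is obtained as follows
([superadditive_invariant_measure]).

Choose points that almost realise [m_N] and average along their orbits up to
time [N].  Superadditivity bounds the average of a truncation of [h_n] by
[n C + o(1)].  Along an ultrafilter the averages converge on every subset of
[Omega * X], but the limit [L] is only finitely additive
([invariant_coupling_exists]).  It becomes a measure after coding [X] by the
Cantor space: on sets that depend on finitely many binary digits of the code,
compactness, together with the fact that the marginal of [L] is [P], makes [L]
countably additive.  The extension [mu] satisfies [L K <= mu K] for every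
measurable [K] with closed sections ([coupling_measure]).  This inequality
contains all that is needed: [mu] lives on [E], has marginal [P], is invariant
([dominates_closed_unique]), and gives the superlevel sets of [h_n] at most
their [L]-mass.

The fiberwise infima are measurable, and sets with closed sections are
approximated by digit sets, thanks to the measurable projection theorem
([measurable_projection]); that is where the completeness of [P] enters. *)

(** * The Souslin operation *)

(** Continuity of [K] for the product topology, in the uniform form that it takes
on the compact boxes [s i <= b i].  Stating the modulus this way avoids any
appeal to compactness when schemes are combined. *)
Definition box_local {Y : Type} (K : (nat -> nat) -> Y) : Prop :=
  forall b : nat -> nat, exists m : nat, forall s t : nat -> nat,
    (forall i, (s i <= b i)%N) -> (forall i, (i < m)%N -> s i = t i) ->
    K s = K t.

(** The usual Souslin operation takes [K n s] to depend on the first [n] terms of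
[s] only.  Local constancy is more flexible: it makes countable unions and
intersections a mere reindexing of sequences. *)
Definition souslin {T : Type} (C : set (set T)) (S : set T) : Prop :=
  exists K : nat -> (nat -> nat) -> set T,
    [/\ forall n s, C (K n s), forall n, box_local (K n) &
        S = [set p | exists s, forall n, K n s p]].

Lemma finite_bound (P : nat -> nat -> Prop) (n : nat) :
  (forall i, exists m, P i m) ->
  (forall i m m', (m <= m')%N -> P i m -> P i m') ->
  exists m, forall i, (i <= n)%N -> P i m.
Proof.
move=> exP monP; elim: n => [|n [m IH]].
  have [m Pm] := exP 0%N.
  by exists m => i; rewrite leqn0 => /eqP ->.
have [m' Pm'] := exP n.+1.
exists (maxn m m') => i; rewrite leq_eqVlt => /orP[/eqP ->|].
  by apply: monP Pm'; rewrite leq_maxr.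
by rewrite ltnS => /IH; apply: monP; rewrite leq_maxl.
Qed.

Section souslin_operations.
Context {T : Type} (C : set (set T)).

Lemma sub_souslin : C `<=` souslin C.
Proof.
move=> A CA; exists (fun _ _ => A); split => // [n b|]; first by exists 0%N.
by apply/seteqP; split => [p Ap|p [_ /(_ 0%N)]//]; exists (fun=> 0%N).
Qed.

(** A sequence [s] codes a sequence of sequences through [pickle]: the [i]-th one
witnesses membership in [S i]. *)
Lemma souslin_bigcap (S : (set T)^nat) :
  (forall i, souslin C (S i)) -> souslin C (\bigcap_i S i).
Proof.
move=> /choice[K HK].
pose c (i n : nat) : nat := pickle (i, n).
pose sub (s : nat -> nat) (i : nat) : nat -> nat := fun n => s (c i n).
pose K' (k : nat) (s : nat -> nat) : set T :=
  let q := odflt (0%N, 0%N) (unpickle k) in K q.1 q.2 (sub s q.1).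
have K'c i n s : K' (c i n) s = K i n (sub s i) by rewrite /K' /c pickleK.
exists K'; split.
- by move=> k s; have [+ _ _] := HK (odflt (0, 0) (unpickle k))%N.1; apply.
- move=> k b; rewrite /K'; set q := odflt _ _.
  have [_ /(_ q.2 (sub b q.1))[m Hm] _] := HK q.1.
  have [M HM] : exists M, forall j, (j <= m)%N -> (c q.1 j < M)%N.
    apply: (@finite_bound (fun j M => (c q.1 j < M)%N)) => [j|j a a' aa' H].
      by exists (c q.1 j).+1.
    exact: leq_trans aa'.
  exists M => s t sb st; apply: Hm => [j|j jm]; first exact: sb.
  by apply: st; apply: HM; exact: ltnW.
- apply/seteqP; split=> [p Sp|p [s Hs] i _].
    have : forall i, exists s, forall n, K i n s p.
      by move=> i; have := Sp i I; have [_ _ ->] := HK i.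
    move=> /choice[ss Hss].
    exists (fun k => let q := odflt (0%N, 0%N) (unpickle k) in ss q.1 q.2).
    move=> k; rewrite /K'; set q := odflt _ (unpickle k).
    rewrite (_ : sub _ _ = ss q.1)//; apply/funext => n.
    by rewrite /sub /c pickleK.
  have [_ _ ->] := HK i; exists (sub s i) => n.
  by rewrite -K'c.
Qed.

(** The first term of [s] selects the index of the union. *)
Lemma souslin_bigcup (S : (set T)^nat) :
  (forall i, souslin C (S i)) -> souslin C (\bigcup_i S i).
Proof.
move=> /choice[K HK].
pose tl (s : nat -> nat) : nat -> nat := fun n => s n.+1.
exists (fun n s => K (s 0%N) n (tl s)); split.
- by move=> n s; have [+ _ _] := HK (s 0%N); apply.
- move=> n b.
  pose good i m := forall s t : nat -> nat, (forall j, (s j <= tl b j)%N) ->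
    (forall j, (j < m)%N -> s j = t j) -> K i n s = K i n t.
  have [m Hm] : exists m, forall i, (i <= b 0)%N -> good i m.
    apply: finite_bound => [i|i m m' mm' H s t sb st].
      by have [_ /(_ n (tl b))[m Hm] _] := HK i; exists m.
    by apply: H => // j jm; apply: st; exact: leq_trans mm'.
  exists m.+1 => s t sb st; rewrite -(st 0%N)//.
  by apply: Hm => // [j|j jm]; [exact: sb|exact: st].
- apply/seteqP; split=> [p [i _]|p [s Hs]].
    have [_ _ ->] := HK i => -[s Hs].
    by exists (fun k => if k is j.+1 then s j else i).
  by exists (s 0%N) => //; have [_ _ ->] := HK (s 0%N); exists (tl s).
Qed.

End souslin_operations.

Lemma ultra_bounded_nat (U : set_system nat) (f : nat -> nat) (b : nat) :
  UltraFilter U -> U [set n | (f n <= b)%N] -> exists v, U [set n | f n = v].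
Proof.
move=> UU; elim: b => [|b IH] Ub.
  by exists 0%N; apply: filterS Ub => n /=; rewrite leqn0 => /eqP.
have [Ueq|Une] := in_ultra_setVsetC [set n | f n = b.+1] UU; first by exists b.+1.
apply: IH; apply: filterS2 Ub Une => n /= fnb nfb.
by rewrite -ltnS ltn_neqAle fnb andbT; apply/eqP.
Qed.

(** Compactness of a box of integer sequences: the [i]-th term of [t] is the value
that [s n i] takes for almost all [n] in the sense of an ultrafilter. *)
Lemma box_compact (b : nat -> nat) (s : nat -> nat -> nat) :
  (forall n i, (s n i <= b i)%N) ->
  exists t, (forall i, (t i <= b i)%N) /\
    forall m N, exists2 n, (N <= n)%N & forall i, (i < m)%N -> s n i = t i.
Proof.
move=> sb; have [U [UU ooU]] := ultraFilterLemma eventually_filter.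
have : forall i, exists v, U [set n | s n i = v].
  by move=> i; apply: (@ultra_bounded_nat U (s^~ i) (b i) UU); apply: filterE => n /=.
move=> /choice[t Ut]; exists t; split=> [i|m N].
  by have [n <-] := filter_ex (Ut i).
have Um : U [set n | forall i, (i < m)%N -> s n i = t i].
  elim: m => [|m IH]; first by apply: filterE.
  apply: filterS2 (Ut m) IH => n /= e H i; rewrite ltnS leq_eqVlt => /orP[/eqP->//|].
  exact: H.
have UN : U [set n | (N <= n)%N] by apply: ooU; exists N.
by have [n [/= Nn Hn]] := filter_ex (filterI UN Um); exists n.
Qed.

(** * Souslin sets are measurable for a complete probability *)

Section souslin_measurable.
Context {d : measure_display} {T : measurableType d} {R : realType}.
Variable P : probability T R.

(** The outer probability of [S] is at most [t]. *)
Definition outer_le (t : R) (S : set T) : Prop :=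
  exists A, [/\ measurable A, S `<=` A & (P A <= t%:E)%E].

(** Outer probability is continuous along increasing sequences, even of
nonmeasurable sets: the cover of [S k] may be replaced by the intersection of all
the later ones. *)
Lemma outer_le_bigcup (t : R) (S : (set T)^nat) :
  (forall m n, (m <= n)%N -> S m `<=` S n) ->
  (forall k, outer_le t (S k)) -> outer_le t (\bigcup_k S k).
Proof.
move=> mono /choice[A HA].
have mA k : measurable (A k) by case: (HA k).
pose B k := \bigcap_(j >= k) A j.
have mB k : measurable (B k) by apply: bigcap_measurable => //; exists k => /=.
have mUB : measurable (\bigcup_k B k) by exact: bigcupT_measurable.
exists (\bigcup_k B k); split => //.
  move=> x [k _ Skx]; exists k => // j /= kj.
  by have [_ + _] := HA j; apply; exact: mono Skx.
have ndB : {homo B : n m / (n <= m)%N >-> (n <= m)%O}.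
  move=> n m nm; apply/subsetPset => x Bx j /= mj.
  by apply: Bx; exact: leq_trans mj.
have cvP := nondecreasing_cvg_mu (mu := P) mB mUB ndB.
rewrite -(cvg_lim (@ereal_hausdorff R) cvP).
apply: lime_le; first by apply/cvg_ex; exists (P (\bigcup_k B k)).
apply: nearW => k /=; have [_ _] := HA k; apply: le_trans.
by apply: le_measure; rewrite ?inE//; apply: bigcap_inf => /=.
Qed.

(** Capacitability.  Bounding the terms of the witnessing sequence one after the
other exhausts [S] by increasing unions, so each bound can be chosen while the
outer probability stays above [t].  What remains is the set with witnesses in a
compact box, and it is a countable intersection of measurable sets. *)
Lemma souslin_inner (S : set T) (t : R) : souslin measurable S ->
  ~ outer_le t S ->
  exists V, [/\ measurable V, V `<=` S & (t%:E <= P V)%E].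
Proof.
move=> [K [mK locK defS]] nS.
pose Sb (b : nat -> nat) k :=
  [set x | exists s, (forall i, (i < k)%N -> (s i <= b i)%N) /\ forall n, K n s x].
have ext (b : nat -> nat) k m : Sb (fun i => if (i == k)%N then m else b i) k =
    Sb b k.
  by apply/seteqP; split=> x [s [sb Hs]]; exists s; split=> // i ik;
    have := sb i ik; rewrite (ltn_eqF ik).
have step (b : nat -> nat) k : ~ outer_le t (Sb b k) ->
    exists m, ~ outer_le t (Sb (fun i => if (i == k)%N then m else b i) k.+1).
  move=> nb; apply/existsNP => H; apply: nb.
  have -> : Sb b k =
      \bigcup_m Sb (fun i => if (i == k)%N then m else b i) k.+1.
    apply/seteqP; split=> [x [s [sb Hs]]|x [m _ [s [sb Hs]]]].
      exists (s k) => //; exists s; split=> // i.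
      by rewrite ltnS leq_eqVlt => /orP[/eqP ->|ik]; rewrite ?eqxx// (ltn_eqF ik) sb.
    exists s; split=> // i ik; have := sb i (ltnW ik : (i < k.+1)%N).
    by rewrite (ltn_eqF ik).
  apply: outer_le_bigcup => // m n mn x [s [sb Hs]]; exists s; split=> // i ik.
  by apply: (leq_trans (sb i ik)); case: ifP.
have [g Hg] : exists g : nat -> (nat -> nat) -> nat, forall k b,
    ~ outer_le t (Sb b k) ->
    ~ outer_le t (Sb (fun i => if (i == k)%N then g k b else b i) k.+1).
  have : forall kb : nat * (nat -> nat), exists m, ~ outer_le t (Sb kb.2 kb.1) ->
      ~ outer_le t (Sb (fun i => if (i == kb.1)%N then m else kb.2 i) kb.1.+1).
    move=> [k b] /=; have [/step[m Hm]|/contrapT H] := pselect (~ outer_le t (Sb b k)).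
      by exists m.
    by exists 0%N.
  by move=> /choice[g Hg]; exists (fun k b => g (k, b)) => k b; exact: (Hg (k, b)).
(* [bb k] records the first [k] bounds; the later entries of [bb k] are
   irrelevant. *)
pose bb := fix bb k : nat -> nat :=
  if k is j.+1 then fun i => if (i == j)%N then g j (bb j) else bb j i
  else fun=> 0%N.
have bbP k : ~ outer_le t (Sb (bb k) k).
  elim: k => [|k IH]; last exact: Hg.
  rewrite (_ : Sb _ _ = S)// defS; apply/seteqP; split=> x [s].
    by move=> [_ Hs]; exists s.
  by move=> Hs; exists s.
pose b i := bb i.+1 i.
have bbE k i : (i < k)%N -> bb k i = b i.
  elim: k => // k IH; rewrite ltnS leq_eqVlt => /orP[/eqP ->//|ik] /=.
  by rewrite (ltn_eqF ik) IH.
have bP k : ~ outer_le t (Sb b k).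
  suff -> : Sb b k = Sb (bb k) k by exact: bbP.
  by apply/seteqP; split=> x [s [sb Hs]]; exists s; split=> // i ik;
    have := sb i ik; rewrite bbE.
pose box := [set s : nat -> nat | forall i, (s i <= b i)%N].
pose V n := [set x | exists2 s, box s & forall j, (j <= n)%N -> K j s x].
have modulus n : exists m, forall s u, box s ->
    (forall i, (i < m)%N -> s i = u i) -> forall j, (j <= n)%N -> K j s = K j u.
  have [m Hm] : exists m, forall j, (j <= n)%N -> forall s u, box s ->
      (forall i, (i < m)%N -> s i = u i) -> K j s = K j u.
    apply: (@finite_bound (fun j m => forall s u, box s ->
        (forall i, (i < m)%N -> s i = u i) -> K j s = K j u)) => [j|j m m' mm' H s u bs su].
      by have [m Hm] := locK j b; exists m => s u bs su; exact: Hm.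
    by apply: H => // i im; apply: su; exact: leq_trans mm'.
  by exists m => s u bs su j jn; exact: Hm.
pose tr m (s : nat -> nat) i := if (i < m)%N then s i else 0%N.
have mV n : measurable (V n).
  have [m Hm] := modulus n.
  (* [V n] only depends on the first [m] terms of the witness, so witnesses
     coded by finite sequences suffice and the union is countable. *)
  have -> : V n = \bigcup_(l : seq nat)
     (if `[< box (nth 0%N l) >] then \bigcap_(j in [set j | (j <= n)%N]) K j (nth 0%N l) else set0).
    apply/seteqP; split=> [x [s bs Hs]|x [l _]].
      exists (mkseq s m) => //.
      have agree i : (i < m)%N -> s i = nth 0%N (mkseq s m) i.
        by move=> im; rewrite nth_mkseq.
      have -> : `[< box (nth 0%N (mkseq s m)) >].
        apply/asboolP => i; have [im|mi] := ltnP i m; first by rewrite -agree.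
        by rewrite nth_default// size_mkseq.
      by move=> j /= jn; rewrite -(Hm s)//; exact: Hs.
    by case: ifPn => // /asboolP bl Hl; exists (nth 0%N l).
  apply: countable_bigcupT_measurable; first exact: countableP.
  move=> l; case: ifP => // _; apply: bigcap_measurable => //.
  by exists 0%N.
exists (\bigcap_n V n); split.
- exact: bigcapT_measurable.
- move=> x Vx.
  have : forall n, exists s, box s /\ forall j, (j <= n)%N -> K j s x.
    by move=> n; have [s bs Hs] := Vx n I; exists s.
  move=> /choice[s /all_and2[bs Hs]].
  have [u [bu Hu]] := box_compact bs.
  rewrite defS; exists u => j.
  have [m Hm] := locK j b.
  have [n jn /(Hm _ _ (bs n)) <-] := Hu m j.
  exact: Hs.
- have niV : {homo V : n m / (n <= m)%N >-> (m <= n)%O}.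
    move=> n m nm; apply/subsetPset => x [s bs Hs]; exists s => // j jn.
    by apply: Hs; exact: leq_trans nm.
  have cvP := nonincreasing_cvg_mu (mu := P)
    (le_lt_trans (probability_le1 P (mV 0%N)) (ltry 1)) mV (bigcapT_measurable mV) niV.
  rewrite -(cvg_lim (@ereal_hausdorff R) cvP).
  apply: lime_ge; first by apply/cvg_ex; eexists; exact: cvP.
  apply: nearW => n /=; rewrite leNgt; apply/negP => PVt.
  have [m Hm] := modulus n.
  apply: (bP m); exists (V n); split => //; last exact: ltW.
  move=> x [s [sb Hs]].
  have btr : box (tr m s) by move=> i; rewrite /tr; case: ifP => // /sb.
  exists (tr m s) => // j jn.
  rewrite (Hm _ s)// => i im; first by rewrite /tr im.
Qed.

Lemma souslin_complete_measurable (S : set T) : measure_is_complete P ->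
  souslin measurable S -> measurable S.
Proof.
move=> cP sS.
pose D := [set t : R | outer_le t S].
have D1 : D 1 by exists setT; split => //; exact: probability_le1.
have D0 t : D t -> 0 <= t.
  by move=> [A [mA _ At]]; rewrite -lee_fin; exact: le_trans At.
have infD : has_inf D by split; [exists 1|exists 0 => t /D0].
have outer n : exists A, [/\ measurable A, S `<=` A &
    (P A <= (inf D + n.+1%:R^-1)%:E)%E].
  have e0 : 0 < n.+1%:R^-1 :> R by rewrite invr_gt0 ltr0n.
  have [t [A [mA SA At]] tlt] := inf_adherent e0 infD.
  by exists A; split => //; apply: le_trans At _; rewrite lee_fin ltW.
have inner n : exists V, [/\ measurable V, V `<=` S &
    ((inf D - n.+1%:R^-1)%:E <= P V)%E].
  apply: souslin_inner => // Dt.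
  have /(ge_inf infD.2) : D (inf D - n.+1%:R^-1) by [].
  by rewrite leNgt ltrBlDr ltrDl invr_gt0 ltr0n.
move/choice : outer => [A HA]; move/choice : inner => [V HV].
have mA : measurable (\bigcap_n A n).
  by apply: bigcapT_measurable => n; case: (HA n).
have mV : measurable (\bigcup_n V n).
  by apply: bigcupT_measurable => n; case: (HV n).
have VS : \bigcup_n V n `<=` S by move=> x [n _]; case: (HV n) => _ + _; apply.
have SA : S `<=` \bigcap_n A n by move=> x Sx n _; case: (HA n) => _ + _; apply.
rewrite -(setDUK VS); apply: measurableU => //; apply: cP.
exists (\bigcap_n A n `\` \bigcup_n V n); split; first exact: measurableD.
  apply/eqP; rewrite eq_le measure_ge0 andbT; apply/lee_addgt0Pr => e e0.
  rewrite add0e.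
  have [n ne] : exists n, n.+1%:R^-1 <= e / 2.
    exists (Num.truncn (e / 2)^-1).
    rewrite -[leRHS]invrK lef_pV2 ?posrE ?invr_gt0 ?divr_gt0//.
    by apply/ltW/truncnS_gt.
  have mAn : measurable (A n) by case: (HA n).
  have mVn : measurable (V n) by case: (HV n).
  have VA : V n `<=` A n.
    by case: (HA n) => _ + _; case: (HV n) => _ + _; exact: subset_trans.
  apply: (@le_trans _ _ (P (A n `\` V n))).
    apply: le_measure; rewrite ?inE; [exact: measurableD|exact: measurableD|].
    by move=> x [Ax nVx]; split; [exact: Ax|move=> Vx; apply: nVx; exists n].
  rewrite measureD//; last by rewrite (le_lt_trans (probability_le1 P mAn)) ?ltry.
  rewrite (setIidr VA).
  have [_ _ PA] := HA n; have [_ _ PV] := HV n.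
  rewrite lee_subel_addr ?fin_num_measure//.
  apply: le_trans PA _; apply: le_trans (leeD2l e%:E PV).
  rewrite -EFinD lee_fin; move: ne; move: (inf D) (n.+1%:R^-1) => D' n'.
  by lra.
by move=> x [Sx nVx]; split => //; exact: SA.
Qed.

End souslin_measurable.

(** * The measurable projection theorem *)

Lemma compact_bigcap_nonempty {T : topologicalType} (D : (set T)^nat) :
  compact [set: T] -> (forall n, closed (D n)) ->
  (forall m n, (m <= n)%N -> D n `<=` D m) -> (forall n, D n !=set0) ->
  \bigcap_n D n !=set0.
Proof.
move=> cT cD decD /choice[x Dx].
have [p [_ clp]] := cT (x @ \oo) _ filterT.
exists p => n _; apply: cD => B /(clp (D n)); apply.
by exists n => // m /= nm; exact: decD (Dx m).
Qed.

Section metric_exhaustion.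
Context {R : realType} {X : metricType R}.

(** Points at distance at least [1 / (k + 1)] from the complement of [U].  These
closed sets, and also their interiors, exhaust an open [U]; the first fact says
that [U] is F_sigma, the second allows to pass from open to closed sets and back
in [dominates_closed_le]. *)
Definition inner_part (U : set X) (k : nat) : set X :=
  [set x | forall y, ~ U y -> k.+1%:R^-1 <= mdist x y].

Lemma closed_inner_part U k : closed (inner_part U k).
Proof.
move=> x clx y nUy; rewrite leNgt; apply/negP => xy.
have r0 : 0 < k.+1%:R^-1 - mdist x y by rewrite subr_gt0.
have [z [Uz]] := clx _ (nbhsx_ballx x (PosNum r0)%:num (gt0 _)).
rewrite ballEmdist /= => xz.
have := Uz y nUy; rewrite leNgt => /negP; apply.
apply: le_lt_trans (metric_triangle z x y) _.
by rewrite (metric_sym z x) -ltrBrDr.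
Qed.

Lemma inner_part_sub U k : inner_part U k `<=` U.
Proof.
move=> x Ux; apply: contrapT => /Ux; rewrite mdistxx leNgt => /negP; apply.
by rewrite invr_gt0 ltr0n.
Qed.

Lemma inner_part_nondecreasing U m n : (m <= n)%N ->
  inner_part U m `<=` inner_part U n.
Proof.
move=> mn x Ux y nUy; apply: le_trans (Ux y nUy).
by rewrite lef_pV2 ?posrE ?ltr0n// ler_nat.
Qed.

Lemma bigcup_interior_inner_part U : open U ->
  \bigcup_k (inner_part U k)° = U.
Proof.
move=> oU; apply/seteqP; split=> [x [k _ /interior_subset /inner_part_sub//]|x Ux].
have : nbhs x U by exact: open_nbhs_nbhs.
rewrite -nbhs_ballE => -[e /= e0 eU].
have [k ke] : exists k, k.+1%:R^-1 <= e / 2.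
  exists (Num.truncn (e / 2)^-1).
  rewrite -[leRHS]invrK lef_pV2 ?posrE ?invr_gt0 ?divr_gt0//.
  by apply/ltW/truncnS_gt.
exists k => //; rewrite /interior -nbhs_ballE /=; exists (e / 2) => /=.
  by rewrite divr_gt0.
move=> y; rewrite ballEmdist /= => xy z nUz; apply: le_trans ke _.
rewrite leNgt; apply/negP => yz; apply: nUz; apply: eU.
rewrite ballEmdist /=; apply: le_lt_trans (metric_triangle x y z) _.
by rewrite (splitr e) ltrD.
Qed.

Lemma bigcup_inner_part U : open U -> \bigcup_k inner_part U k = U.
Proof.
move=> oU; apply/seteqP; split=> [x [k _ /inner_part_sub//]|x].
rewrite -{1}(bigcup_interior_inner_part oU) => -[k _ /interior_subset Ux].
by exists k.
Qed.

End metric_exhaustion.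

Section projection.
Context {R : realType} {d : measure_display} {Omega : measurableType d}.
Context {X : pointedMetricType R}.
Variable P : probability Omega R.
Hypothesis cX : compact [set: X].

Definition closed_rect : set (set (Omega * borel X)) :=
  [set W | exists A C, [/\ measurable A, @closed X C & W = A `*` C]].

Let bisouslin (W : set (Omega * borel X)) :=
  souslin closed_rect W /\ souslin closed_rect (~` W).

Let bisouslin_sigma_algebra : sigma_algebra setT bisouslin.
Proof.
split.
- split.
    apply: sub_souslin; exists set0, set0; split => //; first exact: closed0.
    by rewrite set0X.
  rewrite setC0; apply: sub_souslin; exists setT, setT; split => //.
  by rewrite setXTT.
- by move=> W [? ?]; rewrite /bisouslin setTD setCK; split.
- move=> W HW; split; first by apply: souslin_bigcup => i; case: (HW i).
  by rewrite setC_bigcup; apply: souslin_bigcap => i; case: (HW i).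
Qed.

(** The sets that are Souslin together with their complement form a sigma-algebra
containing the measurable rectangles. *)
Lemma measurable_souslin (W : set (Omega * borel X)) :
  measurable W -> souslin closed_rect W.
Proof.
suff H : measurable `<=` bisouslin by move=> /H[].
rewrite measurable_prod_measurableType.
apply: smallest_sub; first exact: bisouslin_sigma_algebra.
have [_ sC sU] := bisouslin_sigma_algebra.
have bA (A : set Omega) : measurable A -> bisouslin (A `*` setT).
  move=> mA; split; apply: sub_souslin.
    by exists A, setT; split.
  exists (~` A), setT; split => //; first exact: measurableC.
  by apply/seteqP; split=> [[w x] /= /not_andP[//|]|[w x] /= [] nA _ []].
have bI W1 W2 : bisouslin W1 -> bisouslin W2 -> bisouslin (W1 `&` W2).
  move=> b1 b2.
  have : bisouslin (setT `\` (\bigcup_i (setT `\` (if i == 0%N then W1 else W2)))).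
    by apply: (sC); apply: (sU) => i; apply: (sC); case: ifP.
  rewrite setTD setC_bigcup.
  rewrite (_ : \bigcap_i _ = W1 `&` W2)//; apply/seteqP; split=> [p Hp|p [p1 p2] i _].
    by split; apply: contrapT => np; [apply: (Hp 0%N I)|apply: (Hp 1%N I)].
  by move=> -[_]; case: ifP => _; apply.
have bB (B : set (borel X)) : measurable B -> bisouslin (setT `*` B).
  move=> mB.
  suff : measurable `<=` [set B : set (borel X) | bisouslin (setT `*` B)] by apply.
  apply: smallest_sub.
    split.
    - by rewrite /= setX0; case: bisouslin_sigma_algebra.
    - move=> B' /= /sC; congr bisouslin.
      apply/seteqP; split=> [[w x] /= [_ H]|[w x] /= [_ [_ nB]]]; last first.
        by split => // -[].
      by split => //; split=> // Bx; apply: H.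
    - move=> F HF /=.
      have -> : [set: Omega] `*` \bigcup_k F k = \bigcup_k ([set: Omega] `*` F k).
        by apply/seteqP; split=> [[w x] [_ [k _ Fx]]|[w x] [k _ [_ Fx]]];
          [exists k|split=> //; exists k].
      exact: sU.
  move=> U oU; split.
    rewrite -(@bigcup_inner_part R X U oU).
    have -> : [set: Omega] `*` \bigcup_k (@inner_part R X U k) =
      \bigcup_k ([set: Omega] `*` @inner_part R X U k).
      by apply/seteqP; split=> [[w x] [_ [k _ Fx]]|[w x] [k _ [_ Fx]]];
        [exists k|split=> //; exists k].
    apply: souslin_bigcup => k; apply: sub_souslin.
    by exists setT, (@inner_part R X U k); split => //; exact: closed_inner_part.
  apply: sub_souslin; exists setT, (~` U); split => //; first exact: open_closedC.
  by apply/seteqP; split=> [[w x] /= /not_andP[]//|[w x] /= [_ nU] []].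
move=> V [A mA [B mB <-]].
have -> : A `*` B = (A `*` setT) `&` (setT `*` B).
  by apply/seteqP; split=> [[w x] [? ?]|[w x] [[? ?] [? ?]]].
by apply: bI; [exact: bA|exact: bB].
Qed.

(** By compactness, a point [x] common to all the sides [C n s] exists as soon as
every finite intersection of sides is nonempty; so the coordinate [x] can be
eliminated by discarding the rectangles for which such an intersection is
empty. *)
Lemma souslin_projection (W : set (Omega * borel X)) :
  souslin closed_rect W -> souslin measurable (fst @` W).
Proof.
move=> [K [rK locK ->]].
(* The sides are chosen as functions of the rectangle, so that they inherit the
   local constancy of [K]. *)
have : forall V : set (Omega * borel X), exists AC : set Omega * set X,
    closed_rect V -> [/\ measurable AC.1, closed AC.2 & V = AC.1 `*` AC.2].
  move=> V; have [[A [C HV]]|nV] := pselect (closed_rect V); first by exists (A, C).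
  by exists (set0, set0).
move=> /choice[AC HAC].
pose A n s := (AC (K n s)).1; pose C n s := (AC (K n s)).2.
have rKE n s : [/\ measurable (A n s), closed (C n s) & K n s = A n s `*` C n s].
  exact: HAC (rK n s).
pose D n s := \bigcap_(j in [set j | (j <= n)%N]) C j s.
exists (fun n s => if `[< D n s !=set0 >] then A n s else set0); split.
- by move=> n s; case: ifP => // _; have [] := rKE n s.
- move=> n b.
  have [m Hm] : exists m, forall j, (j <= n)%N -> forall s t,
      (forall i, (s i <= b i)%N) -> (forall i, (i < m)%N -> s i = t i) ->
      K j s = K j t.
    apply: (@finite_bound (fun j m => forall s t, (forall i, (s i <= b i)%N) ->
      (forall i, (i < m)%N -> s i = t i) -> K j s = K j t)) => [j|j m m' mm' H s t sb st].
      exact: locK.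
    by apply: H => // i im; apply: st; exact: leq_trans mm'.
  exists m => s t sb st.
  have -> : D n s = D n t by apply: eq_bigcapr => j /= jn; rewrite /C (Hm j jn s t).
  by rewrite /A (Hm n _ s t).
- apply/seteqP; split=> [w [[w' x] /= [s Hs] <-]|w /= [s Hs]].
    exists s => n.
    have Kx j : A j s w' /\ C j s x.
      by have := Hs j; have [_ _ ->] := rKE j s => -[].
    case: asboolP => [_|[]]; first by case: (Kx n).
    by exists x => j _; case: (Kx j).
  have AD n : A n s w /\ D n s !=set0.
    by have := Hs n; case: asboolP.
  have [x Dx] : \bigcap_n D n s !=set0.
    apply: compact_bigcap_nonempty => // [n|m n mn x Dx j /= jm|n].
    - by apply: closed_bigI => j _; have [] := rKE j s.
    - by apply: Dx; exact: leq_trans jm mn.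
    - by case: (AD n).
  exists (w, x) => //=; exists s => n.
  have [_ _ ->] := rKE n s; split=> /=; first by case: (AD n).
  exact: (Dx n I n (leqnn n)).
Qed.

Theorem measurable_projection (W : set (Omega * borel X)) :
  measure_is_complete P -> measurable W -> measurable (fst @` W).
Proof.
move=> cP mW; apply: (souslin_complete_measurable cP).
by apply: souslin_projection; exact: measurable_souslin.
Qed.

End projection.

(** * From finitely additive couplings to measures *)

Definition agree (k : nat) (z z' : cantor_space) : Prop :=
  forall i, (i < k)%N -> z i = z' i.

Lemma cantor_nbhs_agree (z : cantor_space) (k : nat) :
  nbhs z [set z' | agree k z z'].
Proof.
elim: k => [|k IH]; first by apply: filterS filterT.
have nk : nbhs z [set z' : cantor_space | z k = z' k].
  have := @proj_continuous nat (fun _ => bool) k z.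
  move=> /(_ [set b | z k = b]); apply.
  by rewrite nbhs_principalE.
apply: filterS2 nk IH => z' /= zk zz' i.
by rewrite ltnS leq_eqVlt => /orP[/eqP ->//|]; exact: zz'.
Qed.

Lemma cantor_agree_cvg (z : cantor_space) (y : nat -> cantor_space) :
  (forall k, agree k z (y k)) -> y @ \oo --> z.
Proof.
move=> zy; apply/cvg_sup => N U [V] [[W] oW <-] WfN WU.
apply: (filterS WU); rewrite nbhs_simpl; exists N.+1 => // i /= Ni.
by rewrite -(zy i N).
Qed.

Lemma cantor_agree_basis (z : cantor_space) (U : set cantor_space) :
  nbhs z U -> exists k, [set z' | agree k z z'] `<=` U.
Proof.
move=> zU; apply: contrapT => /forallNP H.
have : forall k, exists y, agree k z y /\ ~ U y.
  move=> k; have /existsNP[y /not_implyP[? ?]] := H k; by exists y.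
move=> /choice[y /all_and2[zy nUy]].
have [N _ HN] := cantor_agree_cvg zy zU.
exact: nUy N (HN N (leqnn N)).
Qed.

Lemma agree_closed (k : nat) (Z : set cantor_space) :
  (forall z z', agree k z z' -> Z z -> Z z') -> closed Z.
Proof.
move=> ZZ z clz.
have [z' [Zz' zz']] := clz _ (cantor_nbhs_agree z k).
by apply: ZZ Zz' => i ik; rewrite zz'.
Qed.

(** An alias of [Omega * cantor_space], which carries the algebra of sets below
without conflicting with any product structure. *)
Definition cylinder_product {d} (Omega : measurableType d) : Type :=
  (Omega * cantor_space)%type.

Section cylinder_product.
Context {d : measure_display} {Omega : measurableType d}.

Let T := cylinder_product Omega.

HB.instance Definition _ := Pointed.on (cylinder_product Omega).

(** The sets that depend on finitely many digits and have measurable sections: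
finite unions of products of a measurable set by a cylinder. *)
Definition cylinder_set (W : set T) : Prop :=
  (exists k, forall w z z', agree k z z' -> W (w, z) -> W (w, z')) /\
  forall z, measurable [set w | W (w, z)].

Let agreeC k z z' : agree k z z' -> agree k z' z.
Proof. by move=> H i ik; rewrite H. Qed.

Let cylinder_setT : cylinder_set setT.
Proof.
split; first by exists 0%N.
by move=> z; rewrite (_ : [set _ | _] = setT).
Qed.

Let cylinder_setD : setD_closed cylinder_set.
Proof.
move=> A B [[k Ak] mA] [[l Bl] mB]; split; last by move=> z; exact: (measurableD (mA z) (mB z)).
exists (maxn k l) => w z z' zz' [Az nBz]; split.
  by apply: Ak Az => i ik; apply: zz'; rewrite (leq_trans ik)// leq_maxl.
apply: contra_not nBz; apply: Bl; apply: agreeC => i il; apply: zz'.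
by rewrite (leq_trans il)// leq_maxr.
Qed.

HB.instance Definition _ := isAlgebraOfSets_setD.Build d
  (cylinder_product Omega) cylinder_setT cylinder_setD.

(** Finitely many digits are coded by a finite sequence, hence the union over all
codes is countable. *)
Lemma cylinder_shadow_measurable (W : set T) : measurable W ->
  measurable [set w | exists z, W (w, z)].
Proof.
move=> [[k Wk] mW].
rewrite (_ : [set _ | _] = \bigcup_(l : seq bool) [set w | W (w, nth false l)]).
  by apply: countable_bigcupT_measurable => [|l]; [exact: countableP|exact: mW].
apply/seteqP; split=> [w [z Wz]|w [l _ Wl]]; last by exists (nth false l).
exists (mkseq z k) => //; apply: Wk Wz => i ik.
by rewrite nth_mkseq.
Qed.

End cylinder_product.

Section extension.
Context {R : realType} {d : measure_display} {Omega : measurableType d}.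
Context {X : pointedMetricType R}.
Variable P : probability Omega R.

(** [L] is defined on every subset, measurable or not; this spares all choices of
measurable selections. *)
Record additive_coupling (L : set (Omega * borel X) -> R) : Prop := {
  coupling_ge0 : forall B, 0 <= L B;
  couplingU : forall B C, B `&` C = set0 -> L (B `|` C) = L B + L C;
  coupling_marginal : forall A, measurable A -> (L (A `*` setT))%:E = P A }.

Variable L : set (Omega * borel X) -> R.
Hypothesis aL : additive_coupling L.

Lemma coupling0 : L set0 = 0.
Proof.
have := couplingU aL (setI0 set0); rewrite setU0 => /eqP.
by rewrite -subr_eq0 opprD addrA subrr sub0r oppr_eq0 => /eqP.
Qed.

Lemma couplingT : L setT = 1.
Proof.
have := coupling_marginal aL (@measurableT _ Omega).
by rewrite setXTT probability_setT => -[].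
Qed.

Lemma le_coupling B C : B `<=` C -> L B <= L C.
Proof.
move=> BC; rewrite -(setDUK BC) (couplingU aL); last by rewrite setDE setICA setICr setI0.
by rewrite lerDl coupling_ge0.
Qed.

Lemma couplingC B : L (~` B) = 1 - L B.
Proof.
by rewrite -couplingT -(setUv B) (couplingU aL) ?setICr// addrC addKr.
Qed.

Variables (s : X -> cantor_space).

Let T := cylinder_product Omega.

Definition coupling_content (W : set T) : \bar R :=
  (L [set p | W (p.1, s p.2)])%:E.

Let content0 : coupling_content set0 = 0%E.
Proof. by rewrite /coupling_content (_ : [set _ | _] = set0)// coupling0. Qed.

Let content_ge0 W : (0 <= coupling_content W)%E.
Proof. by rewrite lee_fin coupling_ge0. Qed.

Let contentU V W : V `&` W = set0 ->
  coupling_content (V `|` W) = (coupling_content V + coupling_content W)%E.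
Proof.
move=> VW; rewrite /coupling_content -EFinD -(couplingU aL)//.
by apply/seteqP; split=> // p [Vp Wp]; have : (V `&` W) (p.1, s p.2) by []; rewrite VW.
Qed.

(** The sections of a cylinder set are closed in the Cantor space, so sets that
decrease to the empty set have eventually empty sections; the set of base points
whose section is still nonempty is measurable and decreases to the empty set,
and its probability bounds the content. *)
Let content_vanish (W : (set T)^nat) : (forall n, measurable (W n)) ->
  (forall m n, (m <= n)%N -> W n `<=` W m) -> \bigcap_n W n = set0 ->
  coupling_content (W n) @[n --> \oo] --> 0%E.
Proof.
move=> mW decW W0.
pose A n := [set w | exists z, W n (w, z)].
have mA n : measurable (A n) by exact: cylinder_shadow_measurable.
have capA : \bigcap_n A n = set0.
  apply/seteqP; split=> // w Aw.
  have : \bigcap_n [set z | W n (w, z)] !=set0.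
    apply: compact_bigcap_nonempty.
    - exact: cantor_space_compact.
    - by move=> n; have [[k Wk] _] := mW n; apply: (@agree_closed k) => z z'; exact: Wk.
    - by move=> m n mn z; exact: decW.
    - by move=> n; exact: Aw.
  move=> [z Wz]; have : (\bigcap_n W n) (w, z) by [].
  by rewrite W0.
have PA : P (A n) @[n --> \oo] --> 0%E.
  rewrite -(measure0 P) -capA.
  apply: nonincreasing_cvg_mu => //.
  - by rewrite (le_lt_trans (probability_le1 P (mA 0%N))) ?ltry.
  - exact: bigcapT_measurable.
  - by move=> m n mn; apply/subsetPset => w [z Wz]; exists z; exact: decW Wz.
apply: (@squeeze_cvge _ _ _ _ (cst 0%E) _ (fun n => P (A n))) => //; last exact: cvg_cst.
apply: nearW => n; rewrite content_ge0 /=.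
rewrite -(coupling_marginal aL (mA n)) lee_fin; apply: le_coupling => -[w x] /= Wx.
by split=> //; exists (s x).
Qed.

Let content_sigma_additive : semi_sigma_additive coupling_content.
Proof.
move=> F mF tF mUF.
pose W n := \bigcup_i F i `\` \big[setU/set0]_(i < n) F i.
have mS n : measurable (\big[setU/set0]_(i < n) F i).
  exact: bigsetU_measurable.
have sumF n : (\sum_(0 <= i < n) coupling_content (F i))%E =
    coupling_content (\big[setU/set0]_(i < n) F i).
  elim: n => [|n IH]; first by rewrite big_nil big_ord0 content0.
  rewrite big_nat_recr//= IH big_ord_recr/= contentU//.
  apply/seteqP; split=> // p []; rewrite -bigcup_mkord => -[i /= ni Fi Fn].
  have /trivIsetP/(_ i n I I) := tF; rewrite (ltn_eqF ni) => /(_ isT) FF.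
  by have : (F i `&` F n) p by []; rewrite FF.
have splitF n : coupling_content (\bigcup_i F i) =
    (\sum_(0 <= i < n) coupling_content (F i) + coupling_content (W n))%E.
  rewrite sumF -contentU; last by rewrite /W setDE setICA setICr setI0.
  congr coupling_content; rewrite setDUK// -bigcup_mkord.
  by move=> p [i _ Fi]; exists i.
rewrite (_ : (fun n => _) =
    (fun n => coupling_content (\bigcup_i F i) - coupling_content (W n))%E); last first.
  by apply/funext => n; rewrite (splitF n) addeK.
rewrite -[X in _ --> X]sube0.
apply: cvgeB => //; first exact: cvg_cst.
apply: content_vanish.
- by move=> n; exact: measurableD.
- move=> m n mn; apply: setDS => p; rewrite -!bigcup_mkord => -[i /= im Fi].
  by exists i => //=; exact: leq_trans mn.
- apply/seteqP; split=> // p Wp; have [[i _ Fi] _] := Wp 0%N I.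
  by have [_] := Wp i.+1 I; apply; rewrite -bigcup_mkord; exists i => /=.
Qed.

HB.instance Definition _ := isMeasure.Build _ _ _ coupling_content
  content0 content_ge0 content_sigma_additive.

Lemma coupling_extension : exists mu : {measure set
    (g_sigma_algebraType (@measurable d T)) -> \bar R},
  forall W : set T, measurable W -> mu W = coupling_content W.
Proof.
exists (measure_extension coupling_content) => W mW.
exact: measurable_mu_extE.
Qed.

End extension.

(** The canonical measure structure on [pushforward] takes the measurability of
[phi] as an argument, and therefore has to be named explicitly. *)
Lemma pushforward_probability {R : realType} {d1 d2 : measure_display}
  {T1 : measurableType d1} {T2 : measurableType d2}
  (mu : {measure set T1 -> \bar R}) (phi : T1 -> T2) :
  measurable_fun setT phi -> mu setT = 1%E ->
  exists nu : probability T2 R, forall A, nu A = mu (phi @^-1` A).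
Proof.
move=> mphi mu1.
pose nu0 := measure_function_pushforward__canonical__measure_function_Measure mu mphi.
have nu0T : (nu0 : set T2 -> \bar R) setT = 1%E.
  by rewrite /nu0 /= /pushforward preimage_setT.
pose nu : probability T2 R := HB.pack (nu0 : set T2 -> \bar R)
  (Measure.class nu0) (Measure_isProbability.Build _ _ _ _ nu0T).
by exists nu.
Qed.

Section coupling_measure.
Context {R : realType} {d : measure_display} {Omega : measurableType d}.
Context {X : pointedMetricType R}.
Variable P : probability Omega R.
Hypothesis cP : measure_is_complete P.
Hypothesis cX : compact [set: X].

Let cylT := g_sigma_algebraType (@measurable d (cylinder_product Omega)).

Lemma measurable_decoding (q : cantor_space -> X) : continuous q ->
  measurable_fun setT (fun p : cylT => (p.1, q p.2 : borel X)).
Proof.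
move=> cq; apply: measurable_fun_pair.
  move=> _ A mA; rewrite setTI; apply: sub_sigma_algebra; split; first by exists 0%N.
  by move=> z.
apply: (@measurability _ _ cylT (borel X) setT _ (@open X)) => //.
move=> _ [U oU <-]; rewrite setTI.
rewrite (_ : _ @^-1` _ =
    \bigcup_k [set p : cylT | [set z | agree k p.2 z] `<=` q @^-1` U]).
  apply: bigcupT_measurable => k; apply: sub_sigma_algebra; split.
    exists k => w z z' zz' H y /= z'y; apply: H => i ik.
    by rewrite /= zz'// z'y.
  move=> z /=; have [zU|nzU] := pselect ([set y | agree k z y] `<=` q @^-1` U).
    by rewrite (_ : [set _ | _] = setT)//; apply/seteqP; split.
  by rewrite (_ : [set _ | _] = set0)//; apply/seteqP; split.
apply/seteqP; split=> [[w z] /= Uz|[w z] [k _ /= H]]; last exact: H.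
have : nbhs z (q @^-1` U) by apply: cq; exact: open_nbhs_nbhs.
by move=> /cantor_agree_basis[k Hk]; exists k.
Qed.

(** Code [X] by a continuous surjection [q] from the Cantor space, and let [s] be
any section of [q].  The set [W k] of the points [(w, z)] for which some
[(w, q y)] in [K] has a code [y] with the same [k] first digits as [z] is a
cylinder set by the projection theorem; it contains the coded points of [K], so
its content is at least [L K].  When the sections of [K] are closed, these sets
decrease to the preimage of [K] under the decoding. *)
Theorem coupling_measure (L : set (Omega * borel X) -> R) :
  additive_coupling P L ->
  exists mu : probability (Omega * borel X)%type R,
    forall K : set (Omega * borel X), measurable K ->
      (forall w, closed [set x : X | K (w, x)]) ->
      ((L K)%:E <= mu K)%E.
Proof.
move=> aL.
have hX : hausdorff_space X := @metric_hausdorff R X.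
have [q cq] := cantor_surj cX hX.
have : forall x, exists z, q z = x by move=> x; have [z _ <-] := @surj _ _ _ _ q x I; exists z.
move=> /choice[s qs].
have [mu' mu'E] := coupling_extension aL s.
have mQ := measurable_decoding cq.
pose Q := fun p : cylT => (p.1, q p.2 : borel X).
have mu'T : mu' setT = 1%E.
  rewrite mu'E; last exact: measurableT.
  by rewrite /coupling_content (_ : [set _ | _] = setT)// (couplingT aL).
have [mu muE] := pushforward_probability mQ mu'T.
exists mu => K mK clK.
pose W k : set (cylinder_product Omega) :=
  [set p | exists2 z, agree k p.2 z & K (p.1, q z)].
have mW k : measurable (W k).
  split.
    exists k => w z z' zz' [y zy Ky]; exists y => // i ik /=.
    by rewrite -zz'//; exact: zy.
  move=> z; pose D := q @` [set y | agree k z y].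
  have clD : closed D.
    apply: (compact_closed hX); apply: continuous_compact.
      exact: continuous_subspaceT.
    apply: subclosed_compact cantor_space_compact _ => //.
    apply: (@agree_closed k) => y y' yy' zy i ik.
    by rewrite zy// yy'.
  have mD : measurable (D : set (borel X)).
    rewrite -[D]setCK; apply: measurableC; apply: sub_sigma_algebra.
    exact: closed_openC.
  rewrite (_ : [set _ | _] = fst @` (K `&` (setT `*` (D : set (borel X))))).
    apply: (measurable_projection cX cP).
    by apply: measurableI => //; exact: measurableX.
  apply/seteqP; split=> [w [y zy Ky]|w [[w' x] [Kx [_ [y zy yx]]] <-]].
    by exists (w, q y) => //; split => //; split=> //; exists y.
  by exists y => //=; rewrite yx.
have LW k : ((L K)%:E <= mu' (W k))%E.
  rewrite mu'E// lee_fin; apply: (le_coupling aL) => -[w x] Kx.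
  by exists (s x) => //=; rewrite qs.
have capW : \bigcap_k W k = Q @^-1` K.
  apply/seteqP; split=> [[w z] Wz|[w z] Kz k _]; last by exists z.
  have : forall k, exists y, agree k z y /\ K (w, q y).
    by move=> k; have [y ? ?] := Wz k I; exists y.
  move=> /choice[y /all_and2[zy Ky]].
  have cvqy : q (y n) @[n --> \oo] --> q z.
    apply: (@cvg_comp _ _ _ y q); first exact: cantor_agree_cvg zy.
    exact: cq.
  apply: (clK w) => B /cvqy [N _ HN]; exists (q (y N)); split; first exact: Ky.
  exact: HN (leqnn N).
have mW' k : measurable (W k : set cylT) by exact: sub_sigma_algebra.
have mcapW : measurable (\bigcap_k (W k : set cylT)) by exact: bigcapT_measurable.
have mu'W0 : (mu' (W 0%N) < +oo)%E by rewrite mu'E// ltry.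
have niW : {homo (W : nat -> set cylT) : n m / (n <= m)%N >-> (m <= n)%O}.
  move=> n m nm; apply/subsetPset => p [z pz Kz]; exists z => // i im.
  by apply: pz; exact: leq_trans nm.
have cvW := nonincreasing_cvg_mu mu'W0 mW' mcapW niW.
rewrite muE (_ : _ @^-1` K = \bigcap_k (W k : set cylT)); last by rewrite capW.
rewrite -(cvg_lim (@ereal_hausdorff R) cvW).
apply: lime_ge; first by apply/cvg_ex; eexists; exact: cvW.
by apply: nearW => n; exact: LW.
Qed.

End coupling_measure.

(** * Fiberwise infima *)

Section fiberwise_infimum.
Context {R : realType} {d : measure_display} {Omega : measurableType d}.
Context {X : pointedMetricType R}.
Variables (P : probability Omega R) (E : set (Omega * borel X)).
Hypothesis cP : measure_is_complete P.
Hypothesis cX : compact [set: X].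
Hypothesis mE : measurable E.

Lemma fiberE w x : fiber E w x = E (w, x).
Proof. by rewrite /fiber xsectionE. Qed.

(** Equal to [+oo] over an empty fiber. *)
Definition fiber_inf (g : Omega * borel X -> R) (w : Omega) : \bar R :=
  ereal_inf [set (g (w, x))%:E | x in fiber E w].

Lemma fiber_inf_le g w x : E (w, x) -> (fiber_inf g w <= (g (w, x))%:E)%E.
Proof. by move=> Ex; apply: ereal_inf_lbound; exists x => //; rewrite fiberE. Qed.

Lemma fiber_inf_ge g w (r : \bar R) :
  (forall x, E (w, x) -> (r <= (g (w, x))%:E)%E) -> (r <= fiber_inf g w)%E.
Proof.
move=> H; apply: le_ereal_inf_tmp => _ [x Ex <-]; apply: H.
by rewrite -fiberE.
Qed.

Lemma measurable_fiber_inf g : measurable_fun E g ->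
  measurable_fun setT (fiber_inf g).
Proof.
move=> mg; apply: (measurability _ (ErealGenInftyO.measurableE R)).
move=> _ [_ [r ->] <-]; rewrite setTI.
rewrite (_ : _ @^-1` _ = fst @` (E `&` g @^-1` `]-oo, r[%classic)).
  by apply: (measurable_projection cX cP); apply: mg.
apply/seteqP; split=> [w /=|w [[w' x] [Ex /=] gr <-]].
  rewrite in_itv /= => /ereal_inf_lt[_ [x Ex <-]]; rewrite lte_fin => gr.
  by exists (w, x) => //; split; [rewrite -fiberE|rewrite /= in_itv].
rewrite /= in_itv /=; apply: le_lt_trans (fiber_inf_le g Ex) _.
by move: gr; rewrite in_itv.
Qed.

End fiberwise_infimum.

(** * Truncations and superadditive averages *)

Section threshold_count.
Context {R : realType}.

(** The number of levels [1, ..., M] lying strictly below [s]: an integer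
approximation of [s], cut off at [M], that is a sum of indicator functions.  It
reduces statements on functions to statements on superlevel sets. *)
Definition threshold_count (M : nat) (s : R) : R :=
  \sum_(l < M) (l.+1%:R < s)%R%:R.

Lemma threshold_count_ge0 M s : 0 <= threshold_count M s.
Proof. by apply: sumr_ge0 => l _; case: (_ < _). Qed.

Lemma threshold_count_le M s : threshold_count M s <= M%:R.
Proof.
rewrite /threshold_count -[leRHS]mulr1 mulr_natl -[X in _ *+ X]card_ord -sumr_const.
by apply: ler_sum => l _; case: (_ < _).
Qed.

Lemma threshold_count_le_arg M s : 0 <= s -> threshold_count M s <= s.
Proof.
move=> s0; elim: M => [|M IH]; first by rewrite /threshold_count big_ord0.
rewrite /threshold_count big_ord_recr /=; case: ltP => [Ms|_] /=; last by rewrite addr0.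
apply: le_trans (ltW Ms); rewrite -[M.+1]addn1 natrD lerD2r.
exact: threshold_count_le.
Qed.

Lemma threshold_count_ge M s : s <= M%:R -> s - 1 <= threshold_count M s.
Proof.
suff : Num.min (s - 1) M%:R <= threshold_count M s.
  move=> H sM; apply: le_trans H; rewrite le_min lexx /=.
  by apply: le_trans sM; rewrite lerBlDr lerDl.
elim: M => [|M IH]; first by rewrite /threshold_count big_ord0 ge_min lexx orbT.
rewrite /threshold_count big_ord_recr /= -/(threshold_count M s).
have [Ms|sM] := ltP.
  have : M%:R <= threshold_count M s.
    apply: le_trans IH; rewrite le_min lexx andbT lerBrDr.
    by rewrite -natr1 in Ms; exact: ltW.
  by move=> H; rewrite ge_min -natr1 lerD2r H orbT.
rewrite addr0; apply: le_trans IH; rewrite le_min !ge_min lexx /=.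
by rewrite -natr1 in sM; rewrite lerBlDr sM.
Qed.

End threshold_count.

Section superadditive.
Context {R : realType} {T : Type} (E : set T) (Theta : T -> T).
Variable h : nat -> T -> R.
Hypothesis EE : forall p, E p -> E (Theta p).
Hypothesis h0 : forall n p, (0 < n)%N -> E p -> 0 <= h n p.
Hypothesis hS : forall n m p, (0 < n)%N -> (0 < m)%N -> E p ->
  h n p + h m (iter n Theta p) <= h (n + m)%N p.

Lemma iter_stable k p : E p -> E (iter k Theta p).
Proof. by elim: k => //= k IH /IH; exact: EE. Qed.

Lemma superadditive_tail r N p : (r < N)%N -> E p ->
  h (N - r)%N (iter r Theta p) <= h N p.
Proof.
move=> rN Ep; case: (posnP r) => [->|r0]; first by rewrite subn0.
have Nr0 : (0 < N - r)%N by rewrite subn_gt0.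
rewrite -{2}(subnKC (ltnW rN)); apply: le_trans (hS r0 Nr0 Ep).
by rewrite lerDr h0.
Qed.

Lemma superadditive_blocks n q N p : (0 < n)%N -> (0 < N)%N -> (q * n <= N)%N ->
  E p -> \sum_(i < q) h n (iter (i * n) Theta p) <= h N p.
Proof.
move=> n0; elim: q N p => [|q IH] N p N0 qN Ep; first by rewrite big_ord0 h0.
rewrite big_ord_recl /=.
have nN : (n <= N)%N by apply: leq_trans qN; rewrite mulSn leq_addr.
have -> : \sum_(i < q) h n (iter (bump 0 i * n) Theta p) =
    \sum_(i < q) h n (iter (i * n) Theta (iter n Theta p)).
  by apply: eq_bigr => i _; rewrite -iterD /bump /= add1n mulSn addnC.
have [nlt|] := ltnP n N.
  have Nn0 : (0 < N - n)%N by rewrite subn_gt0.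
  rewrite -(subnKC nN); apply: le_trans (hS n0 Nn0 Ep).
  rewrite lerD2l; apply: IH => //; last exact: iter_stable.
  by rewrite leq_subRL// -mulSn.
move=> Nn; have NnE : N = n by apply/eqP; rewrite eqn_leq Nn nN.
have -> : q = 0%N.
  move: qN; rewrite NnE mulSn -[leqRHS]addn0 leq_add2l leqn0 muln_eq0.
  by rewrite (gtn_eqF n0) orbF => /eqP.
by rewrite big_ord0 addr0 NnE.
Qed.

(** For each residue modulo [n], cutting an orbit of length [N] into blocks of
length [n] that start at this residue gives at most [h N p] by superadditivity;
the incomplete blocks at the end are controlled by the bound [b]. *)
Lemma superadditive_average (g : T -> R) (b : R) n N p : (0 < n)%N -> (0 < N)%N ->
  E p -> (forall q, E q -> 0 <= g q <= h n q) -> (forall q, E q -> g q <= b) ->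
  \sum_(k < N) g (iter k Theta p) <= n%:R * h N p + 2 * n%:R * b.
Proof.
move=> n0 N0 Ep gh gb.
have b0 : 0 <= b by apply: le_trans (gb p Ep); have /andP[] := gh p Ep.
pose q := (N %/ n)%N.
have hN0 : 0 <= h N p by exact: h0.
have qN : (q * n <= N)%N by exact: leq_trunc_div.
have residue r : (r < n)%N ->
    \sum_(i < q) g (iter (i * n + r) Theta p) <= h N p + b.
  move=> rn; case: q qN => [|m] qN; first by rewrite big_ord0 addr_ge0.
  rewrite big_ord_recr /= lerD//; last exact/gb/iter_stable.
  have rN : (m * n + r < N)%N.
    by apply: leq_trans qN; rewrite mulSn addnC ltn_add2r.
  apply: le_trans (@superadditive_tail r N p _ Ep); last first.
    by apply: leq_ltn_trans rN; rewrite leq_addl.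
  apply: (@le_trans _ _ (\sum_(i < m) h n (iter (i * n) Theta (iter r Theta p)))).
    apply: ler_sum => i _; rewrite iterD.
    by have /andP[] := gh _ (iter_stable (i * n) (iter_stable r Ep)).
  apply: superadditive_blocks => //; last exact: iter_stable.
    by rewrite subn_gt0; apply: leq_ltn_trans rN; rewrite leq_addl.
  have rN' : (r <= N)%N by apply/ltnW; apply: leq_ltn_trans rN; rewrite leq_addl.
  by rewrite leq_subRL// addnC ltnW.
have -> : \sum_(k < N) g (iter k Theta p) =
    \sum_(0 <= k < q * n) g (iter k Theta p) + \sum_(q * n <= k < N) g (iter k Theta p).
  by rewrite -big_cat_nat//= big_mkord.
have -> : 2 * n%:R * b = n%:R * b + n%:R * b by ring.
rewrite addrA -mulrDr lerD//.
  rewrite big_nat_mul /= big_mkord.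
  under eq_bigr do rewrite -{1}(add0n (_ * n)%N) big_addn mulSn addnK big_mkord.
  rewrite exchange_big /=.
  rewrite mulr_natl -[X in _ *+ X]card_ord -sumr_const.
  apply: ler_sum => r _; apply: le_trans (residue r (ltn_ord r)).
  by under eq_bigr do rewrite addnC.
apply: (@le_trans _ _ (\sum_(q * n <= k < N) b)).
  by apply: ler_sum => i _; exact/gb/iter_stable.
rewrite sumr_const_nat -(mulr_natl b) ler_wpM2r// ler_nat.
by rewrite {1}(divn_eq N n) -/q addKn ltnW// ltn_pmod.
Qed.

End superadditive.

(** * Limits of averages along orbits *)

Lemma ultra_bounded_cvg {I : Type} {R : realType} (U : set_system I)
  (r : I -> R) (a b : R) : UltraFilter U ->
  U [set i | a <= r i <= b] -> cvg (r @ U).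
Proof.
move=> UU Ur.
have Uab : (r @ U) `[a, b]%classic.
  by apply: (@filterS _ U _ _ _ _ Ur) => i ri /=; rewrite in_itv /=.
have [p [_ clp]] := @segment_compact R a b _ _ Uab.
apply/cvg_ex; exists p => B pB.
have [//|UnB] := in_ultra_setVsetC (r @^-1` B) UU.
by have [q [nBq /nBq]] := clp (~` B) B UnB pB.
Qed.

Section limit_coupling.
Context {R : realType} {d : measure_display} {Omega : measurableType d}.
Context {X : pointedMetricType R}.
Variables (P : probability Omega R) (theta : Omega -> Omega).
Hypothesis mtheta : measurable_fun setT theta.
Hypothesis Ptheta : preserves_measure P theta.
Variable T : Omega -> X -> X.

Let Y := (Omega * borel X)%type.
Let Theta : Y -> Y := skew_product theta T.

Lemma fst_iter_skew k (p : Y) : (iter k Theta p).1 = iter k theta p.1.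
Proof. by elim: k => //= k ->. Qed.

Lemma measurable_iter k : measurable_fun setT (iter k theta).
Proof.
elim: k => [|k IH]; first exact: measurable_id.
exact: (measurableT_comp mtheta IH).
Qed.

Lemma measurable_iter_preimage k A : measurable A ->
  measurable (iter k theta @^-1` A).
Proof. by move=> mA; rewrite -[X in measurable X]setTI; exact: measurable_iter. Qed.

Lemma preserves_iter k A : measurable A -> P (iter k theta @^-1` A) = P A.
Proof.
move=> mA; elim: k => [//|k IH].
rewrite -{}IH -(Ptheta (measurable_iter_preimage k mA)).
by congr (P _); apply/seteqP; split=> w /=; rewrite -iterSr.
Qed.

(** Typically a map with countably many values, constant on measurable pieces.
Composing with it makes every function measurable. *)
Definition simple_tag (p : Omega -> Y) : Prop :=
  forall Q : set Y, measurable (p @^-1` Q).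

(** The probability that the point at a uniformly chosen time before [i.1], on the
orbit of a random tag [i.2 w], lies in [B]. *)
Definition orbit_average (i : nat * (Omega -> Y)) (B : set Y) : R :=
  i.1%:R^-1 * \sum_(k < i.1) fine (P [set w | B (iter k Theta (i.2 w))]).

Lemma orbit_average_ge0 i B : 0 <= orbit_average i B.
Proof.
apply: mulr_ge0; first by rewrite invr_ge0.
by apply: sumr_ge0 => k _; rewrite fine_ge0.
Qed.

Lemma fine_probability_le1 A : measurable A -> fine (P A) <= 1.
Proof.
move=> mA; rewrite -lee_fin fineK ?fin_num_measure//; exact: probability_le1.
Qed.

Lemma simple_tag_iter p k (B : set Y) : simple_tag p ->
  measurable [set w | B (iter k Theta (p w))].
Proof. by move=> sp; exact: (sp (iter k Theta @^-1` B)). Qed.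

Lemma orbit_average_le1 i B : simple_tag i.2 -> orbit_average i B <= 1.
Proof.
move=> si; rewrite /orbit_average; case: (posnP i.1) => [->|i0].
  by rewrite big_ord0 mulr0.
rewrite mulrC ler_pdivrMr ?ltr0n// mul1r.
rewrite -[leRHS]mulr1 mulr_natl -[X in _ *+ X]card_ord -sumr_const.
by apply: ler_sum => k _; apply: fine_probability_le1; exact: simple_tag_iter.
Qed.

Lemma orbit_averageU i B C : simple_tag i.2 -> B `&` C = set0 ->
  orbit_average i (B `|` C) = orbit_average i B + orbit_average i C.
Proof.
move=> si BC; rewrite /orbit_average -mulrDr -big_split/=; congr (_ * _).
apply: eq_bigr => k _.
have mB := simple_tag_iter k B si; have mC := simple_tag_iter k C si.
rewrite -fineD ?fin_num_measure// -measureU//.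
by apply/seteqP; split=> // w [Bw Cw]; have : (B `&` C) (iter k Theta (i.2 w)) by [];
  rewrite BC.
Qed.

(** The sum telescopes. *)
Lemma orbit_average_shift i B : simple_tag i.2 -> (0 < i.1)%N ->
  `|orbit_average i (Theta @^-1` B) - orbit_average i B| <= i.1%:R^-1.
Proof.
move=> si i0; rewrite /orbit_average -mulrBr normrM ger0_norm ?invr_ge0//.
rewrite ler_piMr ?invr_ge0//.
pose a k := fine (P [set w | B (iter k Theta (i.2 w))]).
rewrite (_ : _ - _ = a i.1 - a 0%N); last first.
  rewrite -(telescope_sumr _ (ltnW i0)) -sumrB big_mkord.
  by apply: eq_bigr => k _.
rewrite ler_norml.
have a01 k : 0 <= a k <= 1.
  rewrite fine_ge0//=; apply: fine_probability_le1; exact: simple_tag_iter.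
by have /andP[? ?] := a01 i.1; have /andP[? ?] := a01 0%N; apply/andP; split; lra.
Qed.

Variable U : set_system (nat * (Omega -> Y)).
Hypothesis UU : UltraFilter U.
Hypothesis Utag : forall N, U [set i | (N <= i.1)%N /\ simple_tag i.2].
Hypothesis Umarginal : forall A, measurable A ->
  U [set i | forall k, (k < i.1)%N -> forall w,
               A (iter k theta (i.2 w).1) <-> A (iter k theta w)].

Definition limit_coupling (B : set Y) : R := lim (orbit_average^~ B @ U).

Lemma limit_coupling_cvg B : orbit_average i B @[i --> U] --> limit_coupling B.
Proof.
apply: (@ultra_bounded_cvg _ _ _ _ 0 1 UU).
by apply: filterS (Utag 0) => i [_ si] /=; rewrite orbit_average_ge0 orbit_average_le1.
Qed.

Lemma limit_coupling_near B (c : R) :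
  U [set i | orbit_average i B = c] -> limit_coupling B = c.
Proof. by move=> H; apply: cvg_lim => //; apply: cvg_near_cst. Qed.

(** For the marginal, the averages over the set above [A] are eventually equal to
the probability of [A], since the tags eventually respect [A] along the orbit. *)
Lemma limit_coupling_additive : additive_coupling P limit_coupling.
Proof.
split.
- move=> B; apply: limr_ge; first by apply/cvg_ex; eexists; exact: limit_coupling_cvg.
  by apply: nearW => i; exact: orbit_average_ge0.
- move=> B C BC; apply: cvg_lim => //.
  have H : {near U, (fun i => orbit_average i B) \+ (fun i => orbit_average i C) =1
      (orbit_average^~ (B `|` C))}.
    by apply: filterS (Utag 0) => i [_ si] /=; rewrite orbit_averageU.
  apply: cvg_trans (near_eq_cvg H) _.
  by apply: cvgD; exact: limit_coupling_cvg.
- move=> A mA; rewrite (@limit_coupling_near _ (fine (P A))); last first.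
    apply: filterS2 (Umarginal mA) (Utag 1) => i /= HA [i0 si].
    rewrite /orbit_average (eq_bigr (fun=> fine (P A))).
      rewrite sumr_const card_ord -[X in _ * X]mulr_natl mulrA mulVf ?mul1r//.
      by rewrite pnatr_eq0 -lt0n.
    move=> k _; rewrite -(preserves_iter k mA); congr (fine (P _)).
    apply/seteqP; split=> w /=; rewrite fst_iter_skew.
      by move=> [/(HA _ (ltn_ord k))].
    by move=> /(HA _ (ltn_ord k)).
  by rewrite fineK ?fin_num_measure.
Qed.

Lemma limit_coupling_shift B :
  limit_coupling (Theta @^-1` B) = limit_coupling B.
Proof.
apply/eqP; rewrite -subr_eq0 -normr_le0; apply/ler_addgt0Pr => e e0; rewrite add0r.
have cv : `|orbit_average i (Theta @^-1` B) - orbit_average i B| @[i --> U] -->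
    `|limit_coupling (Theta @^-1` B) - limit_coupling B|.
  by apply: cvg_norm; apply: cvgB; exact: limit_coupling_cvg.
rewrite -(cvg_lim _ cv)//; apply: limr_le; first by apply/cvg_ex; eexists; exact: cv.
apply: filterS (Utag (Num.truncn e^-1).+1) => i [Ni si].
have i0 : (0 < i.1)%N by exact: leq_trans Ni.
apply: le_trans (orbit_average_shift B si i0) _.
rewrite -[leRHS]invrK lef_pV2 ?posrE ?invr_gt0 ?ltr0n//.
apply: le_trans (ltW (truncnS_gt _)) _.
by rewrite ler_nat.
Qed.

Lemma limit_coupling_ge B (c : R) :
  U [set i | c <= orbit_average i B] -> c <= limit_coupling B.
Proof. by move=> H; apply: limr_ge => //; apply/cvg_ex; eexists; exact: limit_coupling_cvg. Qed.

Lemma limit_coupling_sum_le M (B : nat -> set Y) (c : R) :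
  U [set i | \sum_(l < M) orbit_average i (B l) <= c] ->
  \sum_(l < M) limit_coupling (B l) <= c.
Proof.
move=> H.
have cv : \sum_(l < M) orbit_average i (B l) @[i --> U] -->
    \sum_(l < M) limit_coupling (B l).
  apply: cvg_big => [|l _]; first exact: add_continuous.
  exact: limit_coupling_cvg.
rewrite -(cvg_lim _ cv)//; apply: limr_le => //.
by apply/cvg_ex; eexists; exact: cv.
Qed.

End limit_coupling.

(** * An invariant finitely additive coupling *)

Lemma sum_probability_le {R : realType} {d : measure_display}
  {Omega : measurableType d} (P : probability Omega R) (a b : nat)
  (D : nat -> nat -> set Omega) (W : Omega -> \bar R) (alpha beta gamma : R) :
  0 <= alpha -> 0 <= beta -> (forall k l, measurable (D k l)) ->
  measurable_fun setT W -> (forall w, (0 <= W w)%E) ->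
  (forall w, ((\sum_(k < a) \sum_(l < b) \1_(D k l) w)%:E <=
              alpha%:E * W w + beta%:E)%E) ->
  (\int[P]_w W w <= gamma%:E)%E ->
  \sum_(k < a) \sum_(l < b) fine (P (D k l)) <= alpha * gamma + beta.
Proof.
move=> a0 b0 mD mW W0 DW intW.
have mind k l : measurable_fun setT (fun w => (\1_(D k l) w)%:E : \bar R).
  by apply/measurable_EFinP; exact: measurable_indic.
have msum k : measurable_fun setT
    (fun w => \sum_(l < b) (\1_(D k l) w)%:E : \bar R)%E.
  by apply: emeasurable_sum => l; exact: mind.
have E1 : ((\sum_(k < a) \sum_(l < b) fine (P (D k l)))%:E =
    \int[P]_w (\sum_(k < a) \sum_(l < b) \1_(D k l) w)%:E)%E.
  under eq_integral do (rewrite -sumEFin; under eq_bigr do rewrite -sumEFin).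
  rewrite ge0_integral_sum//; last first.
    by move=> k w _; apply: sume_ge0 => l _; rewrite lee_fin.
  rewrite -sumEFin; apply: eq_bigr => k _.
  rewrite ge0_integral_sum//; last first.
  rewrite -sumEFin; apply: eq_bigr => l _.
  by rewrite integral_indic// setIT fineK// fin_num_measure.
rewrite -lee_fin E1.
apply: (@le_trans _ _ (\int[P]_w (alpha%:E * W w + beta%:E))%E).
  apply: ge0_le_integral => //.
  - by move=> w _; rewrite lee_fin; apply: sumr_ge0 => k _; apply: sumr_ge0.
  - apply/measurable_EFinP.
    by apply: measurable_sum => k; apply: measurable_sum => l; exact: measurable_indic.
  - by apply: emeasurable_funD => //; exact: measurable_funeM.
rewrite ge0_integralD//; last 2 first.
- by move=> w _; rewrite mule_ge0// lee_fin.
- exact: measurable_funeM.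
rewrite ge0_integralZl_EFin//.
have -> : (\int[P]_w beta%:E = beta%:E)%E.
  by rewrite integral_cst// [X in (_ * X)%E]probability_setT mule1.
rewrite EFinD EFinM.
by rewrite leeD2r// lee_wpmul2l// lee_fin.
Qed.

Section tagging.
Context {R : realType} {d : measure_display} {Omega : measurableType d}.
Context {X : pointedMetricType R}.
Let Y := (Omega * borel X)%type.
Variable E : set Y.

(** Over each piece of the partition [psi], the tag is a point of [E] that
minimises [g] up to [1] among all the points of [E] over the piece. *)
Lemma exists_tag (g : Y -> R) (psi : Omega -> nat) :
  (forall j, measurable (psi @^-1` [set j])) -> (forall q, E q -> 0 <= g q) ->
  exists p : Omega -> Y, [/\ simple_tag p, forall w, psi (p w).1 = psi w &
    forall q, E q -> E (p q.1) /\ g (p q.1) <= g q + 1].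
Proof.
move=> mpsi g0.
have : forall j, exists r : Y, ((exists w, psi w = j) -> psi r.1 = j) /\
    forall q, psi q.1 = j -> E q -> E r /\ g r <= g q + 1.
  move=> j; pose V := [set g q | q in [set q | psi q.1 = j /\ E q]].
  have [V0|nV0] := pselect (V !=set0).
    have infV : has_inf V by split=> //; exists 0 => _ [q [_ Eq] <-]; exact: g0.
    have [_ [r [rj Er] <-] gr] := inf_adherent (ltr01) infV.
    exists r; split=> // q qj Eq; split=> //; apply: le_trans (ltW gr) _.
    by rewrite lerD2r; apply: ge_inf; [case: infV|exists q].
  have [[w wj]|nw] := pselect (exists w, psi w = j).
    by exists (w, point); split=> // q qj Eq; case: nV0; exists (g q); exists q.
  by exists point; split=> // q qj Eq; case: nV0; exists (g q); exists q.
move=> /choice[r Hr]; exists (r \o psi); split.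
- move=> Q; rewrite (_ : _ @^-1` Q = \bigcup_(j in r @^-1` Q) psi @^-1` [set j]).
    exact: bigcup_measurable.
  by apply/seteqP; split=> [w rw|w [j Qj /= wj]]; [exists (psi w)|rewrite /= wj].
- by move=> w /=; have [-> //] := Hr (psi w); exists w.
- by move=> q Eq /=; have [_] := Hr (psi q.1); exact.
Qed.

End tagging.

Section invariant_coupling.
Context {R : realType} {d : measure_display} {Omega : measurableType d}.
Context {X : pointedMetricType R}.
Variables (P : probability Omega R) (theta : Omega -> Omega).
Hypothesis cP : measure_is_complete P.
Hypothesis cX : compact [set: X].
Hypothesis mtheta : measurable_fun setT theta.
Hypothesis Ptheta : preserves_measure P theta.
Variables (E : set (Omega * borel X)) (T : Omega -> X -> X).

Let Y := (Omega * borel X)%type.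
Let Theta : Y -> Y := skew_product theta T.

Hypothesis mE : measurable E.
Hypothesis EE : forall p, E p -> E (Theta p).
Variables (h : nat -> Y -> R) (C : R).
Hypothesis mh : forall n, (0 < n)%N -> measurable_fun E (h n).
Hypothesis h0 : forall n p, (0 < n)%N -> E p -> 0 <= h n p.
Hypothesis hS : forall n m p, (0 < n)%N -> (0 < m)%N -> E p ->
  h n p + h m (iter n Theta p) <= h (n + m)%N p.
Hypothesis frequently : forall N0, exists N, [/\ (N0 <= N)%N, (0 < N)%N &
  (\int[P]_w fiber_inf E (h N) w <= (N%:R * C)%:E)%E].

Lemma fiber_inf_ge0 n w : (0 < n)%N -> (0 <= fiber_inf E (h n) w)%E.
Proof. by move=> n0; apply: fiber_inf_ge => x Ex; rewrite lee_fin h0. Qed.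

(** The infimum is [+oo] over an empty fiber, and has finite mean for some [N]. *)
Lemma nonempty_fibers : P (fst @` E) = 1%E.
Proof.
have [N [_ N0 intN]] := frequently 0.
have mF : measurable (fst @` E) := measurable_projection cX cP mE.
rewrite -[LHS]oppeK -[1%E]oppeK; congr (- _)%E.
have : P (~` (fst @` E)) = 0%E.
  apply/eqP; rewrite eq_le measure_ge0 andbT leNgt; apply/negP => Pgt0.
  have mw : measurable_fun setT (fiber_inf E (h N)).
    exact: (measurable_fiber_inf cP cX mE (mh N0)).
  have : (+oo * P (~` (fst @` E)) <= (N%:R * C)%:E)%E.
    apply: le_trans intN; rewrite -integral_cst; last exact: measurableC.
    apply: (@le_trans _ _ (\int[P]_(w in ~` (fst @` E)) fiber_inf E (h N) w)%E).
      apply: ge0_le_integral; [exact: measurableC|by move=> w _; exact: leey|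
        exact: measurable_cst|exact: measurable_funTS|].
      move=> w nw; apply: fiber_inf_ge => x Ex; exfalso.
      by apply: nw; exists (w, x).
    apply: ge0_subset_integral => //; first exact: measurableC.
    by move=> w _; exact: fiber_inf_ge0.
  by rewrite gt0_mulye// leye_eq.
rewrite probability_setC// => /eqP; rewrite sube_eq ?fin_num_measure//.
by rewrite add0e => /eqP <-.
Qed.

(** The averaging schemes [(N, p)] that are late enough, respect the partition
[D.2] along orbits of length [N], and whose tags realise the fiberwise infimum of
[h N] up to [1], for a time [N] at which this infimum has small mean. *)
Definition good_tags (D : nat * (Omega -> nat)) : set (nat * (Omega -> Y)) :=
  [set i | [/\ (D.1 <= i.1)%N /\ (0 < i.1)%N, simple_tag i.2,
    forall k, (k < i.1)%N -> forall w,
      D.2 (iter k theta (i.2 w).1) = D.2 (iter k theta w),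
    (\int[P]_w fiber_inf E (h i.1) w <= (i.1%:R * C)%:E)%E &
    forall q, E q -> E (i.2 q.1) /\ h i.1 (i.2 q.1) <= h i.1 q + 1]].

(** Countable partitions rather than finite families of sets: two of them are
refined by pairing, and they are as good for building simple tags. *)
Let countable_partition : set (nat * (Omega -> nat)) :=
  [set D | forall j, measurable (D.2 @^-1` [set j])].

Let tag_filter := filter_from countable_partition good_tags.

Lemma tag_filter_proper : ProperFilter tag_filter.
Proof.
apply: filter_from_proper; first apply: filter_from_filter.
- exists (0%N, fun=> 0%N) => j /=; rewrite preimage_cst; by case: ifP.
- move=> [N phi] [N' phi'] mphi mphi'.
  exists (maxn N N', fun w => pickle (phi w, phi' w)).
    move=> j /=; have [[[a b] <-]|nj] := pselect (exists ab : nat * nat, pickle ab = j).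
      rewrite (_ : _ @^-1` _ = phi @^-1` [set a] `&` phi' @^-1` [set b]).
        exact: measurableI.
      apply/seteqP; split=> [w /= /(pcan_inj pickleK)[-> ->]//|w [/= -> ->]//].
    rewrite (_ : _ @^-1` _ = set0)//; apply/seteqP; split=> // w /= wj.
    by apply: nj; exists (phi w, phi' w).
  move=> i [/= [Ni i0] si iphi ii ti].
  split; split => //.
  - by split=> //; apply: leq_trans Ni; rewrite leq_maxl.
  - by move=> k ki w; have /(pcan_inj pickleK)[] := iphi k ki w.
  - by split=> //; apply: leq_trans Ni; rewrite leq_maxr.
  - by move=> k ki w; have /(pcan_inj pickleK)[] := iphi k ki w.
- move=> [N0 phi] mphi.
  have [N [N0N Npos intN]] := frequently N0.
  pose psi w := pickle [seq phi (iter k theta w) | k <- iota 0 N].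
  have psiE w w' : psi w = psi w' <->
      forall k, (k < N)%N -> phi (iter k theta w) = phi (iter k theta w').
    split=> [/(pcan_inj pickleK) /eq_in_map H k kN|H]; first by apply: H; rewrite mem_iota.
    by congr pickle; apply/eq_in_map => k; rewrite mem_iota => /H.
  have mpsi j : measurable (psi @^-1` [set j]).
    have [[w0 <-]|nj] := pselect (exists w0, psi w0 = j).
      rewrite (_ : _ @^-1` _ = \bigcap_(k in [set k | (k < N)%N])
          iter k theta @^-1` (phi @^-1` [set phi (iter k theta w0)])).
        apply: bigcap_measurable => [|k _]; first by exists 0%N.
        exact: measurable_iter_preimage.
      by apply/seteqP; split=> w /psiE.
    rewrite (_ : _ @^-1` _ = set0)//; apply/seteqP; split=> // w /= wj.
    by apply: nj; exists w.
  have hN0 q : E q -> 0 <= h N q by exact: h0.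
  have [p [sp psip tp]] := exists_tag mpsi hN0.
  exists (N, p); split => //.
  by move=> k kN w; have /psiE := psip w; exact.
Qed.

(** The function [g] below is [h n] cut off at [delta * M] and rounded down to a
multiple of [delta]; its average along the orbit of a good tag is bounded by
[superadditive_average], and the value of [h N] at the tag by the fiberwise
infimum. *)
Lemma good_tags_sum_le D i n M (delta : R) : good_tags D i -> (0 < n)%N -> 0 < delta ->
  \sum_(l < M) orbit_average P theta T i
      (E `&` [set q | l.+1%:R < h n q / delta]) <=
  (n%:R * C + (n%:R + 2 * n%:R * (delta * M%:R)) / i.1%:R) / delta.
Proof.
move=> [[_ i0] si _ inti ti] n0 d0.
pose N := i.1; pose p := i.2.
pose B l := E `&` [set q | l.+1%:R < h n q / delta].
pose g q := delta * threshold_count M (h n q / delta).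
have gh q : E q -> 0 <= g q <= h n q.
  move=> Eq; have hd0 : 0 <= h n q / delta by rewrite divr_ge0//; [exact: h0|exact: ltW].
  apply/andP; split; first by rewrite mulr_ge0 ?threshold_count_ge0// ltW.
  by rewrite /g -ler_pdivlMl// [leRHS]mulrC; exact: threshold_count_le_arg.
have gb q : E q -> g q <= delta * M%:R.
  by move=> _; rewrite /g ler_pM2l//; exact: threshold_count_le.
pose D' (l k : nat) := [set w | B l (iter k Theta (p w))].
have pointwise w : ((\sum_(l < M) \sum_(k < N) (\1_(D' l k) w : R))%:E <=
    (n%:R / delta)%:E * fiber_inf E (h N) w +
    ((n%:R + 2 * n%:R * (delta * M%:R)) / delta)%:E)%E.
  have nd0 : 0 < n%:R / delta by rewrite divr_gt0// ltr0n.
  have [[x Ex]|nE] := pselect (exists x, E (w, x)); last first.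
    have -> : fiber_inf E (h N) w = +oo%E.
      apply/eqP; rewrite -leye_eq; apply: fiber_inf_ge => x Ex.
      by exfalso; apply: nE; exists x.
    by rewrite gt0_muley ?lte_fin// addye// leey.
  have Ep : E (p w) by have [] := ti _ Ex.
  have -> : \sum_(l < M) \sum_(k < N) (\1_(D' l k) w : R) =
      delta^-1 * \sum_(k < N) g (iter k Theta (p w)).
    rewrite exchange_big /= mulr_sumr; apply: eq_bigr => k _.
    rewrite mulrA mulVf ?gt_eqF// mul1r; apply: eq_bigr => l _.
    rewrite indicE; congr ((nat_of_bool _)%:R); apply/idP/idP.
      by rewrite inE => -[].
    by move=> H; rewrite inE; split=> //; exact: iter_stable.
  apply: (@le_trans _ _ (delta^-1 * (n%:R * h N (p w) + 2 * n%:R * (delta * M%:R)))%:E).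
    rewrite lee_fin ler_pM2l ?invr_gt0//.
    exact: (superadditive_average EE h0 hS n0 i0 Ep gh gb).
  have hp : ((h N (p w) - 1)%:E <= fiber_inf E (h N) w)%E.
    apply: fiber_inf_ge => y Ey; rewrite lee_fin lerBlDr.
    by have [] := ti _ Ey.
  apply: (@le_trans _ _ ((n%:R / delta)%:E * (h N (p w) - 1)%:E +
    ((n%:R + 2 * n%:R * (delta * M%:R)) / delta)%:E)%E); last first.
    by rewrite leeD2r// lee_pmul2l// lte_fin.
  rewrite -EFinM -EFinD lee_fin le_eqVlt; apply/orP; left; apply/eqP; ring.
have mD' k l : measurable (D' k l) by exact: (simple_tag_iter theta T l (B k) si).
have mw : measurable_fun setT (fiber_inf E (h N)).
  exact: (measurable_fiber_inf cP cX mE (mh i0)).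
have n0' : 0 <= n%:R :> R by [].
have := @sum_probability_le _ _ _ P M N D' (fiber_inf E (h N)) (n%:R / delta)
  ((n%:R + 2 * n%:R * (delta * M%:R)) / delta) (N%:R * C).
move=> /(_ _ _ mD' mw _ pointwise inti) H.
rewrite /orbit_average -mulr_sumr mulrC ler_pdivrMr ?ltr0n//.
apply: le_trans (H _ _ _) _.
- by rewrite divr_ge0// ltW.
- by rewrite divr_ge0 ?addr_ge0 ?mulr_ge0// ltW.
- by move=> w; exact: fiber_inf_ge0.
rewrite -/N le_eqVlt; apply/orP; left; apply/eqP.
have : N%:R != 0 :> R by rewrite pnatr_eq0 -lt0n.
have : delta != 0 by rewrite gt_eqF.
by move=> ? ?; field; apply/andP.
Qed.

(** The last property says that the integral of [h n] with respect to [L] is at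
most [n * C], for the approximations of [h n] by [threshold_count]. *)
Theorem invariant_coupling_exists : exists L : set Y -> R,
  [/\ additive_coupling P L, forall B, L (Theta @^-1` B) = L B, L E = 1 &
    forall n M delta, (0 < n)%N -> 0 < delta ->
      \sum_(l < M) L (E `&` [set q | l.+1%:R < h n q / delta]) <=
      n%:R * C / delta].
Proof.
have [U [UU FU]] := ultraFilterLemma tag_filter_proper.
have Ugood D : countable_partition D -> U (good_tags D).
  by move=> HD; apply: FU; exists D.
have part0 N : countable_partition (N, fun=> 0%N).
  by move=> j /=; rewrite preimage_cst; case: ifP.
have Utag N : U [set i | (N <= i.1)%N /\ simple_tag i.2].
  by apply: filterS (Ugood _ (part0 N)) => i [[]].
have Umarginal A : measurable A ->
    U [set i | forall k, (k < i.1)%N -> forall w,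
                 A (iter k theta (i.2 w).1) <-> A (iter k theta w)].
  move=> mA; have : countable_partition (0%N, fun w => nat_of_bool (w \in A)).
    move=> j /=.
    have [->|j1] := eqVneq j 1%N.
      rewrite (_ : _ @^-1` _ = A)//; apply/seteqP; split=> w /=.
        by case: (boolP (w \in A)) => [/set_mem|].
      by move=> Aw; rewrite mem_set.
    have [->|j0] := eqVneq j 0%N.
      rewrite (_ : _ @^-1` _ = ~` A); first exact: measurableC.
      apply/seteqP; split=> w /=; first by case: (boolP (w \in A)) => // /negP nA _ /mem_set.
      by move=> Aw; rewrite memNset.
    rewrite (_ : _ @^-1` _ = set0)//; apply/seteqP; split=> // w /=.
    by case: (w \in A) => wj; rewrite -wj ?eqxx in j0 j1.
  move=> /Ugood; apply: filterS => i [_ _ H _ _] k ki w.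
  have /= := H k ki w.
  case: (boolP (iter k theta (i.2 w).1 \in A)) => [/set_mem A1|/negP A1];
    case: (boolP (iter k theta w \in A)) => [/set_mem A2|/negP A2] //= _.
  by split=> /mem_set.
pose L := limit_coupling P theta T U.
have aL : additive_coupling P L by exact: limit_coupling_additive.
exists L; split => //.
- by move=> B; exact: limit_coupling_shift.
- apply/eqP; rewrite eq_le -{1}(couplingT aL) (le_coupling aL)//=.
  apply: limit_coupling_ge => //.
  apply: filterS2 (Ugood _ (part0 0%N)) (Umarginal _ (measurable_projection cX cP mE)).
  move=> i [/= [_ i0] si _ _ ti] im.
  rewrite /orbit_average ler_pdivlMl ?ltr0n// mulr1.
  rewrite -[leLHS]mulr1 mulr_natl -[X in _ *+ X]card_ord -sumr_const.
  apply: ler_sum => k _; rewrite -lee_fin fineK; last first.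
    by rewrite fin_num_measure//; exact: (simple_tag_iter theta T k E si).
  rewrite -nonempty_fibers; apply: le_measure; rewrite ?inE.
  - exact: (measurable_projection cX cP mE).
  - exact: (simple_tag_iter theta T k E si).
  - by move=> w [q Eq <-] /=; apply: iter_stable => //; have [] := ti _ Eq.
- move=> n M delta n0 d0; apply/ler_addgt0Pr => e e0.
  apply: (@limit_coupling_sum_le _ _ _ _ P theta T U UU Utag M
    (fun l => E `&` [set q | l.+1%:R < h n q / delta])).
  pose c := (n%:R + 2 * n%:R * (delta * M%:R)) / delta / e.
  have := Ugood _ (part0 (Num.truncn c).+1); apply: filterS => i gi.
  apply: le_trans (good_tags_sum_le M gi n0 d0) _.
  have [[/= ci i0] _ _ _ _] := gi.
  rewrite mulrDl lerD2l.
  have iR : 0 < i.1%:R :> R by rewrite ltr0n.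
  have : c <= i.1%:R by apply: le_trans (ltW (truncnS_gt c)) _; rewrite ler_nat.
  rewrite /c ler_pdivrMr// => H.
  by rewrite mulrAC ler_pdivrMr// [leRHS]mulrC.
Qed.

End invariant_coupling.

(** * Measures that dominate a coupling on closed sections *)

Section coupling_measure_unique.
Context {R : realType} {d : measure_display} {Omega : measurableType d}.
Context {X : pointedMetricType R}.
Variable P : probability Omega R.
Variable L : set (Omega * borel X) -> R.
Hypothesis aL : additive_coupling P L.

Let measurable_closed (C : set X) : closed C -> measurable (C : set (borel X)).
Proof.
move=> cC; rewrite -[C]setCK; apply: measurableC; apply: sub_sigma_algebra.
exact: closed_openC.
Qed.

Let measurable_open (U : set X) : open U -> measurable (U : set (borel X)).
Proof. by move=> oU; exact: sub_sigma_algebra. Qed.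

Definition dominates_closed (m : probability (Omega * borel X)%type R) : Prop :=
  forall A (C : set X), measurable A -> closed C ->
    ((L (A `*` (C : set (borel X))))%:E <= m (A `*` (C : set (borel X))))%E.

Lemma dominates_closed_marginal m A : dominates_closed m -> measurable A ->
  m (A `*` setT) = P A.
Proof.
move=> dm mA; apply/eqP; rewrite eq_le; apply/andP; split; last first.
  by rewrite -(coupling_marginal aL mA); apply: dm => //; exact: closedT.
have mAT : measurable (A `*` [set: borel X]) by exact: measurableX.
rewrite -[leLHS]oppeK -[leRHS]oppeK leeN2 -(@leeD2lE _ 1%E)//.
rewrite -(probability_setC P mA) -(probability_setC m mAT).
have -> : ~` (A `*` [set: borel X]) = (~` A) `*` [set: borel X].
  by apply/seteqP; split=> [[w x] /= /not_andP[//|]|[w x] /= [] nA _ []].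
rewrite -(coupling_marginal aL (measurableC mA)).
by apply: dm; [exact: measurableC|exact: closedT].
Qed.

(** Take complements: the marginals of [m] and [L] agree. *)
Lemma dominates_closed_open m A (U : set X) : dominates_closed m ->
  measurable A -> open U ->
  (m (A `*` (U : set (borel X))) <= (L (A `*` (U : set (borel X))))%:E)%E.
Proof.
move=> dm mA oU.
have UC : (A `*` (U : set (borel X))) `|` (A `*` (~` U : set (borel X))) = A `*` setT.
  apply/seteqP; split=> [[w x] [[? ?]|[? ?]]//|[w x] [Aw _]].
  by have [Ux|nUx] := pselect (U x); [left|right].
have UC0 : (A `*` (U : set (borel X))) `&` (A `*` (~` U : set (borel X))) = set0.
  by apply/seteqP; split=> // -[w x] [[_ Ux] [_ nUx]]; exact: nUx Ux.
have cC : closed (~` U) by exact: open_closedC.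
have mU : measurable (A `*` (U : set (borel X))).
  by apply: measurableX => //; exact: measurable_open.
have mC : measurable (A `*` (~` U : set (borel X))).
  by apply: measurableX => //; exact: measurable_closed.
have mT : (m (A `*` setT) = m (A `*` (U : set (borel X))) +
    m (A `*` (~` U : set (borel X))))%E by rewrite -UC measureU.
have LT : L (A `*` setT) = L (A `*` (U : set (borel X))) +
    L (A `*` (~` U : set (borel X))) by rewrite -UC (couplingU aL).
move: (dominates_closed_marginal dm mA) (dm _ _ mA cC).
rewrite -(coupling_marginal aL mA) mT LT.
have [a ->] : exists a, m (A `*` (U : set (borel X))) = a%:E.
  by exists (fine (m (A `*` (U : set (borel X))))); rewrite fineK// fin_num_measure.
have [b ->] : exists b, m (A `*` (~` U : set (borel X))) = b%:E.
  by exists (fine (m (A `*` (~` U : set (borel X))))); rewrite fineK// fin_num_measure.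
by move=> -[abL]; rewrite !lee_fin; lra.
Qed.

(** Each [inner_part U k] separates its interior from the complement of [U], so
[L] can be inserted: [m1] is at most [L] on the interior and [L] is at most [m2]
on the closed set. *)
Lemma dominates_closed_le m1 m2 A (U : set X) : dominates_closed m1 ->
  dominates_closed m2 -> measurable A -> open U ->
  (m1 (A `*` (U : set (borel X))) <= m2 (A `*` (U : set (borel X))))%E.
Proof.
move=> d1 d2 mA oU.
pose V k : set (Omega * borel X) := A `*` ((inner_part U k)° : set (borel X)).
have oV k : open (inner_part U k)° by exact: open_interior.
have mV k : measurable (V k) by apply: measurableX => //; exact: measurable_open.
have UV : \bigcup_k V k = A `*` (U : set (borel X)).
  apply/seteqP; split=> [[w x] [k _ [Aw Vx]]|[w x] [Aw /= Ux]].
    by split=> //; exact: (@inner_part_sub _ _ U k _ (interior_subset Vx)).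
  have : (\bigcup_k (inner_part U k)°) x by rewrite bigcup_interior_inner_part.
  by move=> [k _ Vx]; exists k.
have ndV : {homo V : n m / (n <= m)%N >-> (n <= m)%O}.
  move=> n m nm; apply/subsetPset => -[w x] [Aw Vx]; split=> //=.
  by apply: interiorS Vx; exact: inner_part_nondecreasing.
have mUV : measurable (\bigcup_k V k) by exact: bigcupT_measurable.
have cvV := nondecreasing_cvg_mu (mu := m1) mV mUV ndV.
rewrite -UV -(cvg_lim (@ereal_hausdorff R) cvV).
apply: lime_le; first by apply/cvg_ex; eexists; exact: cvV.
apply: nearW => k /=; rewrite UV.
apply: le_trans (dominates_closed_open d1 mA (oV k)) _.
have mC : measurable (A `*` (inner_part U k : set (borel X))).
  by apply: measurableX => //; apply: measurable_closed; exact: closed_inner_part.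
apply: (@le_trans _ _ (m2 (A `*` (inner_part U k : set (borel X))))).
  apply: le_trans (d2 _ _ mA (@closed_inner_part _ _ U k)).
  rewrite lee_fin; apply: (le_coupling aL) => -[w x] [Aw Vx]; split=> //.
  exact: interior_subset Vx.
apply: le_measure; rewrite ?inE//.
  by apply: measurableX => //; exact: measurable_open.
by move=> -[w x] [Aw Cx]; split=> //; exact: inner_part_sub Cx.
Qed.

(** The values of [L] on closed and on open sides pin down the measure of every
rectangle with an open side. *)
Theorem dominates_closed_unique m1 m2 : dominates_closed m1 ->
  dominates_closed m2 -> forall B, measurable B -> m1 B = m2 B.
Proof.
move=> d1 d2 B mB.
pose G : set (set (Omega * borel X)) :=
  [set W | exists A (U : set X), [/\ measurable A, open U &
     W = A `*` (U : set (borel X))]].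
have GT : G setT.
  by exists setT, setT; split => //; [exact: openT|rewrite setXTT].
apply: (measure_unique G (fun=> setT)) => //.
- rewrite measurable_prod_measurableType; apply/seteqP; split.
    apply: smallest_sub; first exact: smallest_sigma_algebra.
    move=> _ [A mA [W mW <-]].
    have mWT : <<s G >> (setT `*` W).
      suff : @measurable _ (borel X) `<=` [set W | <<s G >> (setT `*` W)] by exact.
      have [g0 gC gU] := smallest_sigma_algebra [set: Omega * borel X] G.
      apply: smallest_sub; last first.
        move=> U oU; apply: sub_sigma_algebra.
        by exists setT, U; split.
      split.
      + by rewrite /= setX0.
      + move=> V /= /gC; congr (<<s G >> _).
        apply/seteqP; split=> [[w x] /= [_ H]|[w x] /= [_ [_ nV]]]; last by split=> // -[].
        by split=> //; split=> // Vx; exact: H.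
      + move=> F HF /=; have -> : [set: Omega] `*` \bigcup_k F k = \bigcup_k ([set: Omega] `*` F k).
          by apply/seteqP; split=> [[w x] [_ [k _ Fx]]|[w x] [k _ [_ Fx]]];
            [exists k|split=> //; exists k].
        exact: gU.
    have mAT : <<s G >> (A `*` setT).
      by apply: sub_sigma_algebra; exists A, setT; split => //; exact: openT.
    have -> : A `*` W = (A `*` setT) `&` (setT `*` W).
      by apply/seteqP; split=> [[w x] [? ?]|[w x] [[? ?] [? ?]]].
    exact: (@measurableI _ (g_sigma_algebraType G)).
  apply: smallest_sub; first exact: smallest_sigma_algebra.
  move=> _ [A [U [mA oU ->]]]; apply: sub_sigma_algebra.
  by exists A => //; exists U => //; exact: measurable_open.
- move=> _ _ [A [U [mA oU ->]]] [A' [U' [mA' oU' ->]]].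
  exists (A `&` A'), (U `&` U'); split; [exact: measurableI|exact: openI|].
  by apply/seteqP; split=> [[w x] [[? ?] [? ?]]|[w x] [[? ?] [? ?]]].
- by rewrite bigcup_const.
- move=> _ [A [U [mA oU ->]]]; apply/eqP; rewrite eq_le.
  by rewrite !dominates_closed_le.
- by move=> _; rewrite (le_lt_trans (probability_le1 m1 measurableT))// ltry.
Qed.

End coupling_measure_unique.

(** * An invariant measure with small deficits *)

Section measure_existence.
Context {R : realType} {d : measure_display} {Omega : measurableType d}.
Context {X : pointedMetricType R}.
Variables (P : probability Omega R) (theta : Omega -> Omega).
Hypothesis cP : measure_is_complete P.
Hypothesis cX : compact [set: X].
Hypothesis mtheta : measurable_fun setT theta.
Hypothesis Ptheta : preserves_measure P theta.
Variables (E : set (Omega * borel X)) (T : Omega -> X -> X).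

Let Y := (Omega * borel X)%type.
Let Theta : Y -> Y := skew_product theta T.

Hypothesis hT : bundle_RDS P theta E T.

Let mE : measurable E := bundle_measurable hT.

Lemma skew_stable p : E p -> E (Theta p).
Proof.
case: p => w x; rewrite -fiberE => Ex; rewrite /Theta /skew_product /=.
by rewrite -fiberE; exact: (bundle_maps hT).
Qed.

Lemma closed_fiber w : closed (fiber E w).
Proof.
exact: (compact_closed (@metric_hausdorff R X) (bundle_compact hT (w := w))).
Qed.

Lemma closed_fiber_preimage {Z : topologicalType} w (g : X -> Z) (C : set Z) :
  {within fiber E w, continuous g} -> closed C ->
  closed (fiber E w `&` g @^-1` C).
Proof.
move=> /continuous_closedP cg cC.
have /closed_subspaceP[V cV VC] := cg _ cC.
by rewrite setIC -VC; apply: closedI => //; exact: closed_fiber.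
Qed.

Lemma measurable_skew : measurable_fun E Theta.
Proof.
move=> _ B mB; rewrite -[X in measurable X]setTI.
pose tau : Y -> borel X := (fun p => T p.1 p.2 : borel X) \_ E.
have mtau : measurable_fun setT tau.
  by apply/(measurable_restrictT _ mE); exact: (bundle_map_measurable hT).
have m1 : measurable_fun setT (fun p : Y => (theta p.1, tau p)).
  apply: measurable_fun_pair => //.
  exact: (measurableT_comp mtheta measurable_fst).
rewrite setTI (_ : E `&` Theta @^-1` B = E `&` (fun p : Y => (theta p.1, tau p)) @^-1` B).
  by apply: measurableI => //; rewrite -[X in measurable X]setTI; exact: m1.
apply/seteqP; split=> p [Ep Bp]; split=> //; move: Bp;
  by rewrite /= /tau patchE mem_set.
Qed.

Variables (h : nat -> Y -> R) (C : R).
Hypothesis mch : forall n, (0 < n)%N -> measurable_continuous E (h n).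
Hypothesis h0 : forall n p, (0 < n)%N -> E p -> 0 <= h n p.
Hypothesis hS : forall n m p, (0 < n)%N -> (0 < m)%N -> E p ->
  h n p + h m (iter n Theta p) <= h (n + m)%N p.
Hypothesis frequently : forall N0, exists N, [/\ (N0 <= N)%N, (0 < N)%N &
  (\int[P]_w fiber_inf E (h N) w <= (N%:R * C)%:E)%E].

(** Let [mu] be the measure attached to the coupling [L].  Both [mu] and its image
under the skew product dominate [L] on closed sections, the latter because [L] is
invariant and [T] is continuous on almost every fiber; so they are equal.  The
bound on the integrals comes from the superlevel sets of [h n], which are open in
the fibers and hence have at most their [L]-mass. *)
Theorem superadditive_invariant_measure : exists mu : probability Y R,
  invariant_measure P theta E T mu /\
  forall n, (0 < n)%N -> (\int[mu]_(p in E) (h n p)%:E <= (n%:R * C)%:E)%E.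
Proof.
have mh n : (0 < n)%N -> measurable_fun E (h n) by move=> /mch[].
have [L [aL Lshift LE Llayer]] :=
  invariant_coupling_exists cP cX mtheta Ptheta mE skew_stable mh h0 hS frequently.
have [mu muL] := coupling_measure cP cX aL.
have LEI B : L (E `&` B) = L B.
  apply/eqP; rewrite eq_le (le_coupling aL) ?andbT; last exact: subIsetr.
  have -> : B = (E `&` B) `|` (~` E `&` B) by rewrite -setIUl setUv setTI.
  rewrite (couplingU aL); last by rewrite setIACA setICr set0I.
  rewrite setIUr setIA setIid [E `&` (~` E `&` B)]setIA setICr set0I setU0.
  rewrite gerDl; apply: (@le_trans _ _ (L (~` E))); last by rewrite (couplingC aL) LE subrr.
  by apply: (le_coupling aL); exact: subIsetl.
(* The sections need only be closed over a set of full probability. *)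
have muLae (K : set Y) (G : set Omega) : measurable K -> measurable G -> P (~` G) = 0%E ->
    (forall w, G w -> closed [set x : X | K (w, x)]) -> ((L K)%:E <= mu K)%E.
  move=> mK mG PG cK.
  have mGT : measurable (G `*` [set: borel X]) by exact: measurableX.
  have LK : L K <= L (K `&` (G `*` setT)).
    have -> : L K = L (K `&` (G `*` setT)) + L (K `\` (G `*` setT)).
      rewrite -(couplingU aL) ?setUIDK//.
      by rewrite setDE setIACA setICr setI0.
    rewrite gerDl; have <- : L ((~` G) `*` setT) = 0.
      by apply/EFin_inj; rewrite (coupling_marginal aL)//; exact: measurableC.
    apply: (le_coupling aL) => -[w x] [_ /= nG]; split=> //= Gw.
    by apply: nG.
  apply: (@le_trans _ _ (L (K `&` (G `*` setT)))%:E); first by rewrite lee_fin.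
  apply: le_trans (muL _ _ _) _; first exact: measurableI.
    move=> w; have [Gw|nGw] := pselect (G w).
      rewrite (_ : [set _ | _] = [set x : X | K (w, x)]); first exact: cK.
      by apply/seteqP; split=> x /=; tauto.
    rewrite (_ : [set _ | _] = set0); first exact: closed0.
    by apply/seteqP; split=> x //= [_ []].
  by apply: le_measure; rewrite ?inE//; exact: measurableI.
have cE w : closed [set x : X | E (w, x)].
  rewrite (_ : [set _ | _] = fiber E w); first exact: closed_fiber.
  by apply/seteqP; split=> x; rewrite /= fiberE.
have muE : mu E = 1%E.
  apply/eqP; rewrite eq_le probability_le1//=.
  by have := muL _ mE cE; rewrite LE.
have muEc : mu (~` E) = 0%E by rewrite probability_setC// muE subee.
have muEI B : measurable B -> mu (E `&` B) = mu B.
  move=> mB; apply/eqP; rewrite eq_le; apply/andP; split.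
    by apply: le_measure; rewrite ?inE//; exact: measurableI.
  have mEB : measurable (E `&` B) by exact: measurableI.
  have mEcB : measurable (~` E `&` B) by apply: measurableI => //; exact: measurableC.
  have <- : (E `&` B) `|` (~` E `&` B) = B by rewrite -setIUl setUv setTI.
  apply: le_trans (measureU2 mu mEB mEcB) _.
  rewrite [X in (_ <= X)%E](_ : _ = mu (E `&` B) + 0)%E; last first.
    by rewrite adde0 setIUr setIA setIid [E `&` (~` E `&` B)]setIA setICr set0I setU0.
  by rewrite leeD2l// -muEc; apply: le_measure; rewrite ?inE//; exact: measurableC.
have dmu : dominates_closed L mu.
  move=> A B mA cB.
  have mAB : measurable (A `*` (B : set (borel X))).
    apply: measurableX => //; rewrite -[B]setCK; apply: measurableC.
    by apply: sub_sigma_algebra; exact: closed_openC.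
  apply: muL => // w; have [Aw|nAw] := pselect (A w).
    rewrite (_ : [set _ | _] = B)//.
    by apply/seteqP; split=> x /=; tauto.
  rewrite (_ : [set _ | _] = set0); first exact: closed0.
  by apply/seteqP; split=> x //= [].
have muP A : measurable A -> mu (A `*` setT) = P A.
  exact: (dominates_closed_marginal aL dmu).
(* The skew product is measurable on [E] only, hence the restriction, which
   takes a constant value on the null set outside [E]. *)
pose Theta' : Y -> Y := Theta \_ E.
have mTheta' : measurable_fun setT Theta'.
  by apply/(measurable_restrictT _ mE); exact: measurable_skew.
have [nu nuE] := pushforward_probability mTheta' (probability_setT mu).
have mpre B : measurable B -> measurable (E `&` Theta @^-1` B).
  by move=> mB; exact: measurable_skew.
have nuI B : measurable B -> nu B = mu (E `&` Theta @^-1` B).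
  move=> mB; transitivity (mu (Theta' @^-1` B)); first exact: nuE.
  rewrite -(muEI (Theta' @^-1` B)); last first.
    by rewrite -[X in measurable X]setTI; exact: mTheta'.
  congr (mu _); apply/seteqP; split=> p [Ep]; rewrite /= /Theta' patchE mem_set//.
have dnu : dominates_closed L nu.
  move=> A B mA cB.
  have mAB : measurable (A `*` (B : set (borel X))).
    apply: measurableX => //; rewrite -[B]setCK; apply: measurableC.
    by apply: sub_sigma_algebra; exact: closed_openC.
  rewrite nuI// -Lshift -LEI.
  have [N [mN PN NT]] := bundle_map_continuous hT.
  apply: (muLae _ (~` N)).
  - exact: mpre.
  - exact: measurableC.
  - by rewrite setCK.
  move=> w nNw.
  have cT : {within fiber E w, continuous (T w)}.
    by apply: contrapT => nc; apply: nNw; exact: NT.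
  have [Aw|nAw] := pselect (A (theta w)).
    rewrite (_ : [set _ | _] = fiber E w `&` T w @^-1` B).
      exact: closed_fiber_preimage.
    by apply/seteqP; split=> x /=; rewrite fiberE; tauto.
  rewrite (_ : [set _ | _] = set0); first exact: closed0.
  by apply/seteqP; split=> x //= [_ []].
exists mu; split.
  split=> // B mB.
  by rewrite -nuI// muEI//; apply: (dominates_closed_unique aL dnu dmu).
move=> n n0.
have [mhn chn] := mch n0.
have mh_le (t : R) : measurable (E `&` [set q | h n q <= t]).
  have -> : [set q | h n q <= t] = h n @^-1` `]-oo, t]%classic.
    by apply/seteqP; split=> q /=; rewrite in_itv.
  exact: mhn.
have layerE (delta : R) l : 0 < delta ->
    E `&` [set q | l.+1%:R < h n q / delta] =
    E `\` (E `&` [set q | h n q <= l.+1%:R * delta]).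
  move=> delta0; apply/seteqP; split=> q [Eq] /=.
    by rewrite ltr_pdivlMr// => lt; split=> // -[_ /=]; rewrite leNgt lt.
  by move=> nK; split=> //; rewrite /= ltr_pdivlMr// ltNge; apply/negP => le; apply: nK.
have mu_layer (delta : R) l : 0 < delta ->
    (mu (E `&` [set q | (l.+1%:R < h n q / delta)%R]) <=
     (L (E `&` [set q | (l.+1%:R < h n q / delta)%R]))%:E)%E.
  move=> delta0; set K := E `&` [set q | h n q <= l.+1%:R * delta].
  have mK : measurable K by exact: mh_le.
  rewrite layerE// -/K.
  have -> : (mu (E `\` K) = mu E - mu K)%E.
    rewrite measureD//; last by rewrite [X in (X < _)%E]muE ltry.
    by rewrite [E `&` K]setIidr//; exact: subIsetl.
  rewrite muE setDE LEI (couplingC aL) EFinB leeB//.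
  apply: muL => // w.
  rewrite (_ : [set _ | _] = fiber E w `&` (fun x => h n (w, x)) @^-1` [set t | t <= l.+1%:R * delta]).
    by apply: closed_fiber_preimage; [exact: chn|exact: closed_le].
  by apply/seteqP; split=> x /=; rewrite fiberE.
(* On the set where [h n <= b], the function [h n] exceeds its approximation by
   [threshold_count] by at most [delta]. *)
have bounded (b delta : R) : 0 < delta -> 
    (\int[mu]_(p in E `&` [set q | (h n q <= b)%R]) (h n p)%:E <=
     (n%:R * C + delta)%:E)%E.
  move=> delta0.
  pose M := (Num.truncn (b / delta)).+1.
  pose S l := E `&` [set q | l.+1%:R < h n q / delta].
  have mS l : measurable (S l).
    by rewrite /S layerE//; apply: measurableD => //; exact: mh_le.
  have mind l : measurable_fun setT (fun p => (\1_(S l) p)%:E : \bar R).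
    by apply/measurable_EFinP; exact: measurable_indic.
  have msum : measurable_fun setT (fun p => \sum_(l < M) (\1_(S l) p)%:E : \bar R)%E.
    by apply: emeasurable_sum => l; exact: mind.
  have sum0 p : (0 <= \sum_(l < M) (\1_(S l) p)%:E :> \bar R)%E.
    by apply: sume_ge0 => l _; rewrite lee_fin.
  have d0 : (0 <= delta%:E)%E by rewrite lee_fin ltW.
  apply: (@le_trans _ _ (\int[mu]_p (delta%:E * \sum_(l < M) (\1_(S l) p)%:E + delta%:E))%E).
    apply: (@le_trans _ _ (\int[mu]_(p in E `&` [set q | (h n q <= b)%R]) (delta%:E * \sum_(l < M) (\1_(S l) p)%:E + delta%:E))%E).
      apply: ge0_le_integral => //.
      - by move=> p [Ep _]; rewrite lee_fin h0.
      - apply/measurable_EFinP; apply: measurable_funS mhn => //; exact: subIsetl.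
      - apply: measurable_funTS; apply: emeasurable_funD => //.
        exact: measurable_funeM.
      - move=> p [Ep /= hb]; rewrite sumEFin -EFinM -EFinD lee_fin.
        have := @threshold_count_ge R M (h n p / delta).
        have -> : h n p / delta <= M%:R.
          apply: le_trans (ltW (truncnS_gt _)).
          by rewrite ler_pM2r// invr_gt0.
        move=> /(_ isT); rewrite /threshold_count lerBlDr ler_pdivrMr//.
        rewrite mulrDl mul1r mulrC => H; apply: le_trans H _.
        rewrite lerD2r ler_pM2l//; apply: ler_sum => l _.
        by rewrite indicE; case: ltP => //= H'; rewrite mem_set.
    apply: ge0_subset_integral => //.
      by apply: emeasurable_funD => //; exact: measurable_funeM.
    by move=> p _; rewrite adde_ge0// mule_ge0.
  rewrite ge0_integralD//; last 2 first.
  - by move=> p _; rewrite mule_ge0.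
  - exact: measurable_funeM.
  rewrite (ge0_integralZl_EFin mu measurableT _ msum (ltW delta0))//.
  have -> : (\int[mu]_p delta%:E = delta%:E)%E.
    by rewrite integral_cst// [X in (_ * X)%E]probability_setT mule1.
  rewrite EFinD leeD2r//.
  rewrite ge0_integral_sum//.
  apply: (@le_trans _ _ (delta%:E * (\sum_(l < M) L (S l))%:E)%E).
    rewrite lee_wpmul2l// -sumEFin; apply: lee_sum => l _.
    by rewrite integral_indic// setIT; exact: mu_layer.
  rewrite -EFinM lee_fin -ler_pdivlMl// mulrC.
  exact: Llayer.
have -> : E = \bigcup_k (E `&` [set q | h n q <= k%:R]).
  apply/seteqP; split=> [q Eq|q [k _ []//]].
  exists (Num.truncn (h n q)).+1 => //; split=> //=.
  exact: ltW (truncnS_gt _).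
have nd : nondecreasing_seq (fun k => E `&` [set q | h n q <= k%:R]).
  move=> k l kl; apply/subsetPset => q [Eq hk]; split=> //=.
  by apply: le_trans hk _; rewrite ler_nat.
have mk k : measurable_fun (E `&` [set q | h n q <= k%:R]) (fun p => (h n p)%:E).
  by apply/measurable_EFinP; apply: measurable_funS mhn => //; exact: subIsetl.
have k0 k p : (E `&` [set q | h n q <= k%:R]) p -> (0 <= (h n p)%:E)%E.
  by move=> [Ep _]; rewrite lee_fin h0.
have cv := ge0_nondecreasing_set_cvg_integral (mu := mu) nd (fun k => mh_le k%:R) mk k0.
rewrite -(cvg_lim (@ereal_hausdorff R) cv).
apply: lime_le; first by apply/cvg_ex; eexists; exact: cv.
apply: nearW => k; apply/lee_addgt0Pr => delta delta0.
by rewrite -EFinD; exact: bounded.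
Qed.

End measure_existence.

(** * Integrals and fiberwise suprema *)

Section integral_comparison.
Context {R : realType} {d : measure_display} {T : measurableType d}.
Variable mu : {measure set T -> \bar R}.
Local Open Scope ereal_scope.

(** Integrals of nonmeasurable functions are still monotone, as differences of
suprema over simple functions below the positive and negative parts.  So the
logarithm of the pressure sum can be compared with measurable functions without
being known to be measurable. *)
Lemma le_integral_pointwise (D : set T) (f g : T -> \bar R) :
  (forall x, D x -> f x <= g x) ->
  \int[mu]_(x in D) f x <= \int[mu]_(x in D) g x.
Proof.
move=> fg; have fgD x : (f \_ D) x <= (g \_ D) x.
  by rewrite !patchE; case: ifPn => // /set_mem; exact: fg.
rewrite /integral; apply: leeB; apply: ereal_sup_le => _ [k /= kf <-];
  exists k => //= x; apply: le_trans (kf x) _; rewrite ?funeposE ?funenegE.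
  by rewrite ge_max !le_max fgD lexx orbT.
by rewrite ge_max !le_max leeN2 fgD lexx orbT.
Qed.

(** Both sides are [-oo] when [w] is not integrable. *)
Lemma integral_sub_ge0 (D : set T) (b : T -> R) (w : T -> \bar R) :
  measurable D -> mu.-integrable D (EFin \o b) -> measurable_fun D w ->
  (forall x, D x -> 0 <= w x) ->
  \int[mu]_(x in D) ((b x)%:E - w x) =
  \int[mu]_(x in D) (b x)%:E - \int[mu]_(x in D) w x.
Proof.
move=> mD ib mw w0.
have [woo|] := ltP (\int[mu]_(x in D) w x) +oo.
  rewrite (integralB _ ib)//; apply/integrableP; split => //.
  by under eq_integral => x /[!inE] Dx do rewrite gee0_abs ?w0//.
rewrite leye_eq => /eqP woo; rewrite woo addeNy.
have mb : measurable_fun D (EFin \o b) by case/integrableP: ib.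
have mu_ : measurable_fun D (fun x => (b x)%:E - w x).
  exact: emeasurable_funB.
rewrite integralE.
suff -> : \int[mu]_(x in D) ((fun x => (b x)%:E - w x)^\-) x = +oo by rewrite addeNy.
apply/eqP; rewrite -leye_eq leNgt; apply/negP => negoo.
have /integrableP[_ iboo] := ib.
have : \int[mu]_(x in D) w x <=
    \int[mu]_(x in D) (`|(b x)%:E| + ((fun x => (b x)%:E - w x)^\-) x).
  apply: le_integral_pointwise => x Dx; rewrite funenegE.
  have := w0 x Dx; case: (w x) => [r| |] // _.
    have -> : maxe (- ((b x)%:E - r%:E)) 0 = (Num.max (r - b x) 0)%:E.
      by rewrite -EFinB -EFinN opprB EFin_max.
    rewrite -EFinD lee_fin; have := ler_norm (b x).
    by have : (r - b x <= Num.max (r - b x) 0)%R; [rewrite le_max lexx|lra].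
rewrite ge0_integralD//; last 2 first.
- exact: measurableT_comp.
- exact: measurable_funeneg.
by rewrite woo leye_eq => /eqP H; have := lte_add_pinfty iboo negoo; rewrite H ltxx.
Qed.

End integral_comparison.

Section fiber_supremum.
Context {R : realType} {d : measure_display} {Omega : measurableType d}.
Context {X : pointedMetricType R}.
Variables (P : probability Omega R) (E : set (Omega * borel X)).
Hypothesis cP : measure_is_complete P.
Hypothesis cX : compact [set: X].
Hypothesis mE : measurable E.
Hypothesis cE : forall w, compact (fiber E w).
Variable g : Omega * borel X -> R.

Definition fiber_supnorm (w : Omega) : \bar R :=
  (maxe 0 (ereal_sup [set `|g (w, x)|%:E | x in fiber E w]))%E.

Lemma fiber_supnormE w :
  fiber_supnorm w = maxe 0%E (- fiber_inf E (fun p => (- `|g p|)%R) w)%E.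
Proof.
congr maxe; rewrite /fiber_inf /ereal_inf oppeK; congr ereal_sup.
apply/seteqP; split=> [_ [x Ex <-]|_ [_ [x Ex <-] <-]].
  by exists (- `|g (w, x)|)%:E; [exists x|rewrite -EFinN opprK].
by exists x => //; rewrite -EFinN opprK.
Qed.

Lemma measurable_fiber_supnorm : measurable_fun E g ->
  measurable_fun setT fiber_supnorm.
Proof.
move=> mg; apply: (eq_measurable_fun (fun w =>
    maxe 0%E (- fiber_inf E (fun p => (- `|g p|)%R) w)%E)).
  by move=> w _; rewrite fiber_supnormE.
apply: measurable_maxe => //; apply: measurableT_comp => //.
apply: (measurable_fiber_inf cP cX mE).
by apply: measurableT_comp => //; exact: measurableT_comp.
Qed.

Lemma fiber_supnorm_fin : (forall w, {within fiber E w, continuous (fun x : X => g (w, x))}) ->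
  forall w, fiber_supnorm w \is a fin_num.
Proof.
move=> cg w.
have cgE : compact ((fun x : X => g (w, x)) @` fiber E w).
  by apply: continuous_compact; [exact: cg|exact: cE].
have [M [_ /(_ (M + 1))HM]] := compact_bounded cgE.
have {}HM x : E (w, x) -> `|g (w, x)| <= M + 1.
  by move=> Ex; apply: HM; [rewrite ltrDl|exists x => //; rewrite fiberE].
rewrite ge0_fin_numE; last by rewrite le_max lexx.
apply: (@le_lt_trans _ _ (Num.max 0 (M + 1))%:E); last exact: ltry.
rewrite EFin_max; apply: le_max2; first exact: lexx.
by apply: ge_ereal_sup => _ [x Ex <-]; rewrite lee_fin; apply: HM; rewrite -fiberE.
Qed.

Lemma le_fiber_supnorm w x : E (w, x) -> (`|g (w, x)|%:E <= fiber_supnorm w)%E.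
Proof.
move=> Ex; rewrite le_max; apply/orP; right; apply: ereal_sup_ubound.
by exists x => //; rewrite fiberE.
Qed.

End fiber_supremum.

(** * Counting separated points *)

Section separated_count.
Context {R : realType} {d : measure_display} {Omega : measurableType d}.
Context {X : pointedMetricType R}.
Hypothesis cX : compact [set: X].
Variables (theta : Omega -> Omega) (E : set (Omega * borel X)).
Variables (T : Omega -> X -> X).

Lemma finite_labelling (e : R) : 0 < e -> exists (M : nat) (c : X -> nat),
  (forall x, (c x < M)%N) /\ forall x y, c x = c y -> mdist x y <= e.
Proof.
move=> e0; have e20 : 0 < e / 2 by rewrite divr_gt0.
have : cover_compact [set: X] by rewrite -compact_cover.
move=> /(_ X setT (fun x => (ball x (e / 2))°))[|x _|D _ cov].
- by move=> x _; exact: open_interior.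
- by exists x => //; exact: nbhsx_ballx.
have : forall x, exists y, y \in finmap.enum_fset D /\ ball y (e / 2) x.
  by move=> x; have [y /= yD /interior_subset xy] := cov x I; exists y.
move=> /choice[c /all_and2[cD cx]].
exists (size (finmap.enum_fset D)), (fun x => index (c x) (finmap.enum_fset D)); split.
  by move=> x; rewrite index_mem.
move=> x y xy.
have cxy : c x = c y.
  by rewrite -(nth_index point (cD x)) xy nth_index.
apply: le_trans (metric_triangle x (c x) y) _; rewrite (splitr e) lerD//.
  by have := cx x; rewrite ballEmdist /= metric_sym => /ltW.
by have := cx y; rewrite -cxy ballEmdist /= => /ltW.
Qed.

Lemma bowen_dist_le w (e : R) n x y : 0 <= e ->
  (forall k, (k < n)%N ->
    mdist (T_iter theta T k w x) (T_iter theta T k w y) <= e) ->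
  bowen_dist theta T w n x y <= e.
Proof. by move=> e0 H; apply: bigmax_le => // k _; exact: H. Qed.

(** Distinct separated points have distinct itineraries of labels. *)
Lemma separated_card w (e : R) n (F : set X) M (c : X -> nat) (s : seq X) :
  0 <= e -> (forall x, (c x < M)%N) -> (forall x y, c x = c y -> mdist x y <= e) ->
  bowen_separated theta E T w e n F -> uniq s -> (forall x, x \in s -> F x) ->
  (size s <= M ^ n)%N.
Proof.
move=> e0 cM ce [_ sepF] us sF.
pose itin x : {ffun 'I_n -> 'I_M} := [ffun k : 'I_n => Ordinal (cM (T_iter theta T k w x))].
have inj : {in s &, injective itin}.
  move=> x y xs ys xy; apply: contrapT => nxy.
  have := sepF x y (sF _ xs) (sF _ ys) nxy; rewrite ltNge => /negP; apply.
  apply: bowen_dist_le => // k kn; apply: ce.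
  have := congr1 (fun i : {ffun 'I_n -> 'I_M} => i (Ordinal kn)) xy.
  by rewrite !ffunE /= => -[].
rewrite -(size_map itin); have : uniq (map itin s) by rewrite map_inj_in_uniq.
by move=> /card_uniqP <-; rewrite (leq_trans (max_card _))// card_ffun !card_ord.
Qed.

Variable f : nat -> Omega * borel X -> R.

Lemma pressure_fiber_le w (e : R) n M (c : X -> nat) (b : R) :
  0 <= e -> (forall x, (c x < M)%N) -> (forall x y, c x = c y -> mdist x y <= e) ->
  (forall x, E (w, x) -> f n (w, x) <= b) ->
  (pressure_fiber theta E T f w e n <= ((M ^ n)%:R * expR b)%:E)%E.
Proof.
move=> e0 cM ce fb; apply: ge_ereal_sup => _ [F sepF <-].
apply: ge_ereal_sup => _ [A [finA AF] <-].
rewrite fsbig_finite//= sumEFin lee_fin.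
apply: (@le_trans _ _ (\sum_(x <- finmap.enum_fset (fset_set A)) expR b)).
  rewrite big_seq [leRHS]big_seq; apply: ler_sum => x xA.
  rewrite ler_expR; apply: fb; rewrite -fiberE.
  have [+ _] := sepF; apply; apply: AF.
  by move: xA; rewrite in_fset_set// inE.
rewrite big_const_seq count_predT iter_addr_0 -(mulr_natl (expR b)).
rewrite ler_wpM2r ?expR_ge0// ler_nat.
apply: (separated_card e0 cM ce sepF) => [|x xA]; first exact: finmap.fset_uniq.
by apply: AF; move: xA; rewrite in_fset_set// inE.
Qed.

Lemma pressure_fiber_ge w (e : R) n x : E (w, x) ->
  ((expR (f n (w, x)))%:E <= pressure_fiber theta E T f w e n)%E.
Proof.
move=> Ex; apply: ereal_sup_ubound; exists [set x]; last first.
  by rewrite esum_set1// lee_fin expR_ge0.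
by split=> [y ->|y z -> ->//]; rewrite fiberE.
Qed.

Lemma pressure_fiber_empty w (e : R) n : (forall x, ~ E (w, x)) ->
  (pressure_fiber theta E T f w e n <= 0)%E.
Proof.
move=> nE; apply: ge_ereal_sup => _ [F [FE _] <-].
rewrite (_ : F = set0) ?esum_set0//; apply/seteqP; split=> // x /FE.
by rewrite fiberE => /nE.
Qed.

End separated_count.

(** * Pressure, deficits and invariant measures *)

Lemma ge0_integral_image {R : realType} {d1 d2 : measure_display}
  {T1 : measurableType d1} {T2 : measurableType d2}
  (mu : {measure set T1 -> \bar R}) (nu : {measure set T2 -> \bar R})
  (phi : T1 -> T2) (u : T2 -> \bar R) :
  measurable_fun setT phi -> (forall A, measurable A -> mu (phi @^-1` A) = nu A) ->
  measurable_fun setT u -> (forall y, (0 <= u y)%E) ->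
  (\int[mu]_x u (phi x) = \int[nu]_y u y)%E.
Proof.
move=> mphi munu mu_ u0.
transitivity (\int[pushforward mu phi]_y u y)%E.
  by rewrite (ge0_integral_pushforward mphi)// preimage_setT.
pose m := measure_function_pushforward__canonical__measure_function_Measure mu mphi.
by apply: (@eq_measure_integral _ _ _ setT nu m u) => A mA _; rewrite -munu.
Qed.

(** Without a limit, [lim] returns the default value [0], which is not [-oo]
either. *)
Lemma lim_neq_Ny {R : realType} {I : Type} (F : set_system I) (FF : ProperFilter F)
  (u : I -> \bar R) (r : R) :
  (\forall i \near F, (r%:E <= u i)%E) -> lim (u @ F) <> -oo%E.
Proof.
move=> ru; have [cv|ncv] := pselect (cvg (u @ F)); last by rewrite dvgP.
move=> limNy; have : (r%:E <= -oo)%E by rewrite -limNy; exact: lime_ge.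
by rewrite leNgt ltNyr.
Qed.

Section reduction.
Context {R : realType} {d : measure_display} {Omega : measurableType d}.
Context {X : pointedMetricType R}.
Variables (P : probability Omega R) (theta : Omega -> Omega).
Variables (E : set (Omega * borel X)) (T : Omega -> X -> X).
Variable f : nat -> Omega * borel X -> R.
Hypothesis cP : measure_is_complete P.
Hypothesis mtheta : measurable_fun setT theta.
Hypothesis Ptheta : preserves_measure P theta.
Hypothesis cX : compact [set: X].
Hypothesis hT : bundle_RDS P theta E T.
Hypothesis hsub : subadditive_sequence theta E T f.
Hypothesis hf1 : L1_continuous P E (f 1%N).
Hypothesis hf : forall n, (0 < n)%N -> measurable_continuous E (f n).

Let Y := (Omega * borel X)%type.
Let Theta : Y -> Y := skew_product theta T.
Let mE : measurable E := bundle_measurable hT.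
Let EE : forall p, E p -> E (Theta p) := skew_stable hT.

Definition step_bound (w : Omega) : R := fine (fiber_supnorm E (f 1%N) w).

Lemma step_boundE w : (step_bound w)%:E = fiber_supnorm E (f 1%N) w.
Proof.
rewrite fineK//; apply: fiber_supnorm_fin; first exact: (bundle_compact hT).
by case: hf1 => -[].
Qed.

Lemma step_bound_ge0 w : 0 <= step_bound w.
Proof. by rewrite -lee_fin step_boundE le_max lexx. Qed.

Lemma le_step_bound p : E p -> f 1%N p <= step_bound p.1.
Proof.
case: p => w x Ex; apply: le_trans (ler_norm _) _.
by rewrite -lee_fin step_boundE; exact: le_fiber_supnorm.
Qed.

Lemma measurable_step_bound : measurable_fun setT step_bound.
Proof.
apply: measurableT_comp => //; apply: (measurable_fiber_supnorm cP cX mE).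
by case: hf1 => -[].
Qed.

Lemma integrable_step_bound : P.-integrable setT (EFin \o step_bound).
Proof.
apply/integrableP; split; first exact/measurable_EFinP/measurable_step_bound.
have [_] := hf1; apply: le_lt_trans.
rewrite /L1_norm; apply: le_integral_pointwise => w _.
by rewrite /= ger0_norm ?step_bound_ge0// step_boundE.
Qed.

Definition mean_bound : R := fine (\int[P]_w (step_bound w)%:E)%E.

Lemma mean_boundE k :
  (\int[P]_w (step_bound (iter k theta w))%:E)%E = mean_bound%:E.
Proof.
rewrite /mean_bound fineK; last exact: (integrable_fin_num measurableT integrable_step_bound).
apply: (@ge0_integral_image _ _ _ _ _ P P (iter k theta) (EFin \o step_bound)).
- exact: measurable_iter.
- exact: preserves_iter.
- exact/measurable_EFinP/measurable_step_bound.
- by move=> w; rewrite lee_fin step_bound_ge0.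
Qed.

Definition orbit_bound (n : nat) (w : Omega) : R :=
  \sum_(k < n) step_bound (iter k theta w).

Lemma measurable_orbit_bound n : measurable_fun setT (orbit_bound n).
Proof.
apply: measurable_sum => k; apply: measurableT_comp; first exact: measurable_step_bound.
exact: measurable_iter.
Qed.

Lemma orbit_bound_ge0 n w : 0 <= orbit_bound n w.
Proof. by apply: sumr_ge0 => k _; exact: step_bound_ge0. Qed.

Lemma orbit_boundD n m w :
  orbit_bound (n + m) w = orbit_bound n w + orbit_bound m (iter n theta w).
Proof.
rewrite /orbit_bound big_split_ord /=; congr (_ + _).
by apply: eq_bigr => k _; rewrite -iterD addnC.
Qed.

Lemma integral_orbit_bound n :
  (\int[P]_w (orbit_bound n w)%:E)%E = (n%:R * mean_bound)%:E.
Proof.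
under eq_integral do rewrite -sumEFin.
rewrite ge0_integral_sum//.
- under eq_bigr do rewrite mean_boundE.
  by rewrite sumEFin sumr_const card_ord mulr_natl.
- move=> k; apply/measurable_EFinP.
  apply: measurableT_comp; first exact: measurable_step_bound.
  exact: measurable_iter.
- by move=> k w _; rewrite lee_fin step_bound_ge0.
Qed.

Lemma integrable_orbit_bound n : P.-integrable setT (EFin \o orbit_bound n).
Proof.
apply/integrableP; split; first exact/measurable_EFinP/measurable_orbit_bound.
under eq_integral do rewrite /= ger0_norm ?orbit_bound_ge0//.
by rewrite integral_orbit_bound ltry.
Qed.

Lemma le_orbit_bound n p : (0 < n)%N -> E p -> f n p <= orbit_bound n p.1.
Proof.
elim: n p => // -[|n] IH p _ Ep.
  by rewrite /orbit_bound big_ord1; exact: le_step_bound.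
apply: le_trans (hsub (isT : (0 < 1)%N) (isT : (0 < n.+1)%N) Ep) _.
rewrite -[X in orbit_bound X]add1n orbit_boundD lerD//.
  by rewrite /orbit_bound big_ord1; exact: le_step_bound.
exact: (IH (Theta p) isT (EE Ep)).
Qed.

Definition deficit (n : nat) (p : Y) : R := orbit_bound n p.1 - f n p.

Lemma deficit_ge0 n p : (0 < n)%N -> E p -> 0 <= deficit n p.
Proof. by move=> n0 Ep; rewrite subr_ge0; exact: le_orbit_bound. Qed.

Lemma deficit_superadditive n m p : (0 < n)%N -> (0 < m)%N -> E p ->
  deficit n p + deficit m (iter n Theta p) <= deficit (n + m)%N p.
Proof.
move=> n0 m0 Ep; rewrite /deficit orbit_boundD fst_iter_skew.
have := hsub n0 m0 Ep; rewrite -/Theta; lra.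
Qed.

Lemma deficit_measurable_continuous n : (0 < n)%N ->
  measurable_continuous E (deficit n).
Proof.
move=> n0; have [mf cf] := hf n0; split.
  apply: measurable_funB => //; apply: measurable_funTS.
  apply: measurableT_comp; [exact: measurable_orbit_bound|exact: measurable_fst].
move=> w; have /subspace_continuousP H := cf w.
apply/subspace_continuousP => x Ex.
by apply: cvgB => /=; [exact: cvg_cst|exact: H].
Qed.

Definition min_deficit (n : nat) : Omega -> \bar R := fiber_inf E (deficit n).

Lemma measurable_min_deficit n : (0 < n)%N -> measurable_fun setT (min_deficit n).
Proof.
by move=> n0; apply: (measurable_fiber_inf cP cX mE); have [] := deficit_measurable_continuous n0.
Qed.

Lemma min_deficit_ge0 n w : (0 < n)%N -> (0 <= min_deficit n w)%E.
Proof. by move=> n0; apply: fiber_inf_ge => x Ex; rewrite lee_fin deficit_ge0. Qed.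

(** The negation of: the mean of [min_deficit N] divided by [N] tends to
[+oo]. *)
Definition recurrent_deficit : Prop := exists C : R, forall N0, exists N,
  [/\ (N0 <= N)%N, (0 < N)%N &
      (\int[P]_w min_deficit N w <= (N%:R * C)%:E)%E].

Lemma integral_orbit_bound_sub n : (0 < n)%N ->
  (\int[P]_w ((orbit_bound n w)%:E - min_deficit n w) =
   (n%:R * mean_bound)%:E - \int[P]_w min_deficit n w)%E.
Proof.
move=> n0; rewrite integral_sub_ge0//.
- by rewrite integral_orbit_bound.
- exact: integrable_orbit_bound.
- exact: measurable_min_deficit.
- by move=> w _; exact: min_deficit_ge0.
Qed.

(** Singletons are separated. *)
Lemma log_pressure_ge n w (e : R) : (0 < n)%N ->
  ((orbit_bound n w)%:E - min_deficit n w <=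
   lne (pressure_fiber theta E T f w e n))%E.
Proof.
move=> n0; have [[x0 Ex0]|nE] := pselect (exists x, E (w, x)); last first.
  have -> : min_deficit n w = +oo%E.
    apply/eqP; rewrite -leye_eq; apply: fiber_inf_ge => x Ex.
    by exfalso; apply: nE; exists x.
  by rewrite addeNy leNye.
have Hx x : E (w, x) -> ((f n (w, x))%:E <= lne (pressure_fiber theta E T f w e n))%E.
  move=> Ex; have pge := pressure_fiber_ge theta T f e n Ex.
  have -> : (f n (w, x))%:E = lne (expR (f n (w, x)))%:E.
    by rewrite lne_EFin ?expR_gt0// expRK.
  rewrite lee_lne// in_itv /= leey andbT ?lee_fin ?expR_ge0//.
  by apply: le_trans pge; rewrite lee_fin expR_ge0.
case: (lne _) Hx => [y| |] Hx; [|by rewrite leey|].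
  rewrite leeBlDr; last first.
    rewrite ge0_fin_numE ?min_deficit_ge0//.
    by apply: le_lt_trans (fiber_inf_le _ Ex0) _; rewrite ltry.
  rewrite -leeBlDl//; apply: fiber_inf_ge => x Ex.
  rewrite -EFinB lee_fin /deficit /=; have := Hx x Ex; rewrite lee_fin; lra.
by have := Hx x0 Ex0; rewrite leeNy_eq.
Qed.

Lemma log_pressure_le n w (e : R) M (c : X -> nat) : (0 < n)%N -> 0 <= e ->
  (forall x, (c x < M)%N) -> (forall x y, c x = c y -> mdist x y <= e) ->
  (lne (pressure_fiber theta E T f w e n) <=
   ((orbit_bound n w + n%:R * ln M%:R)%:E - min_deficit n w))%E.
Proof.
move=> n0 e0 cM ce; have [[x0 Ex0]|nE] := pselect (exists x, E (w, x)); last first.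
  rewrite le0_lneNy ?leNye//; apply: pressure_fiber_empty => x Ex.
  by apply: nE; exists x.
have M0 : (0 < M)%N by apply: leq_ltn_trans (cM x0).
have wfin : min_deficit n w \is a fin_num.
  rewrite ge0_fin_numE ?min_deficit_ge0//.
  by apply: le_lt_trans (fiber_inf_le _ Ex0) _; rewrite ltry.
set r := fine (min_deficit n w); rewrite -(fineK wfin) -/r.
have fb x : E (w, x) -> f n (w, x) <= orbit_bound n w - r.
  move=> Ex; rewrite lerBrDr addrC -lerBrDr -/(deficit n (w, x)) -lee_fin.
  by rewrite /r fineK//; exact: fiber_inf_le.
have := pressure_fiber_le theta T e0 cM ce fb.
set b := expR _ => pb.
have b0 : 0 < (M ^ n)%:R * b by rewrite mulr_gt0 ?expR_gt0// ltr0n expn_gt0 M0.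
apply: (@le_trans _ _ (lne ((M ^ n)%:R * b)%:E)).
  rewrite lee_lne// in_itv /= leey andbT ?lee_fin ?(ltW b0)//.
  apply: le_trans (pressure_fiber_ge theta T f e n Ex0).
  by rewrite lee_fin expR_ge0.
rewrite lne_EFin// lnM ?posrE ?expR_gt0 ?ltr0n ?expn_gt0 ?M0//.
rewrite /b expRK -EFinB lee_fin natrX lnXn ?ltr0n// mulr_natl; lra.
Qed.

Lemma recurrent_pressure_ge (C e : R) :
  (forall N0, exists N, [/\ (N0 <= N)%N, (0 < N)%N &
      (\int[P]_w min_deficit N w <= (N%:R * C)%:E)%E]) ->
  ((mean_bound - C)%:E <= pressure_scale P theta E T f e)%E.
Proof.
move=> HC; apply: le_ereal_inf_tmp => _ [V [N0 _ VN0] <-].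
have [N [N0N Npos intN]] := HC N0.
apply: le_ereal_sup_tmp; exists (N%:R^-1%:E * \int[P]_w lne (pressure_fiber theta E T f w e N))%E.
  by exists N => //; exact: VN0.
apply: (@le_trans _ _ (N%:R^-1%:E * \int[P]_w ((orbit_bound N w)%:E - min_deficit N w))%E).
  rewrite integral_orbit_bound_sub//.
  have N0R : 0 < N%:R :> R by rewrite ltr0n.
  rewrite lee_pdivlMl// -EFinM mulrBr EFinB leeB//.
rewrite lee_wpmul2l// ?lee_fin ?invr_ge0//.
by apply: le_integral_pointwise => w _; exact: log_pressure_ge.
Qed.

Lemma not_recurrent_deficit (C : R) : ~ recurrent_deficit ->
  \forall N \near \oo, (0 < N)%N /\ ((N%:R * C)%:E < \int[P]_w min_deficit N w)%E.
Proof.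
move=> nrec; apply: contrapT => nnear; apply: nrec; exists C => N0.
apply: contrapT => /forallNP nN; apply: nnear; exists N0.+1 => // N /= N0N.
have Npos : (0 < N)%N by exact: leq_ltn_trans N0N.
split=> //; rewrite ltNge; apply/negP => intN.
by apply: (nN N); split=> //; exact: ltnW.
Qed.

Lemma pressure_scaleNy (e : R) : 0 < e -> ~ recurrent_deficit ->
  pressure_scale P theta E T f e = -oo%E.
Proof.
move=> e0 nrec; have [M [c [cM ce]]] := finite_labelling cX e0.
suff cv : (n%:R^-1%:E * \int[P]_w lne (pressure_fiber theta E T f w e n))%E
    @[n --> \oo] --> -oo%E.
  by rewrite /pressure_scale (cvgNy_limn_einf_sup cv).2.
apply/cvgeNyPle => A.
apply: filterS (not_recurrent_deficit (mean_bound + ln M%:R - A) nrec) => N [N0 intN].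
have NR : 0 < N%:R :> R by rewrite ltr0n.
rewrite lee_pdivrMl//.
apply: (@le_trans _ _ (\int[P]_w ((orbit_bound N w + N%:R * ln M%:R)%:E - min_deficit N w))%E).
  by apply: le_integral_pointwise => w _; apply: log_pressure_le => //; exact: ltW.
rewrite integral_sub_ge0//; last 3 first.
- rewrite (_ : _ \o _ = (EFin \o orbit_bound N) \+ cst (N%:R * ln M%:R)%:E)%E//.
  apply: integrableD => //; first exact: integrable_orbit_bound.
  exact: finite_measure_integrable_cst.
- exact: measurable_min_deficit.
- by move=> w _; exact: min_deficit_ge0.
have -> : (\int[P]_w (orbit_bound N w + N%:R * ln M%:R)%:E =
    (N%:R * (mean_bound + ln M%:R))%:E)%E.
  under eq_integral do rewrite EFinD.
  rewrite integralD//; last 2 first.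
  - exact: integrable_orbit_bound.
  - exact: finite_measure_integrable_cst.
  rewrite integral_orbit_bound mulrDr EFinD; congr (_ + _)%E.
  by rewrite integral_cst// [X in (_ * X)%E]probability_setT mule1.
apply: le_trans (leeB (lexx _) (ltW intN)) _.
rewrite -EFinB -EFinM lee_fin -mulrBr ler_pM2l//.
by lra.
Qed.

(** At every scale the pressure lies between the upper limit of
[mean_bound - (mean of min_deficit n) / n] and the same limit plus the logarithm
of the number of labels at this scale. *)
Theorem pressure_eqNy :
  pressure P theta E T f = -oo%E <-> ~ recurrent_deficit.
Proof.
split=> [pNy [C HC]|nrec].
  move: pNy; apply: (@lim_neq_Ny _ _ _ _ _ (mean_bound - C)).
  by apply: nearW => e; exact: recurrent_pressure_ge.
apply: cvg_lim => //; apply: cvg_near_cst.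
near=> e; apply: pressure_scaleNy => //.
Unshelve. all: by end_near. Qed.

Section invariant.
Variable mu : probability Y R.
Hypothesis hmu : invariant_measure P theta E T mu.

Lemma integral_marginal (u : Omega -> \bar R) : measurable_fun setT u ->
  (forall w, (0 <= u w)%E) ->
  (\int[mu]_(p in E) u p.1 = \int[P]_w u w)%E.
Proof.
move=> mu_ u0.
have mEc : measurable (~` E) by exact: measurableC.
have muEc : mu (~` E) = 0%E.
  by rewrite probability_setC// (invariant_support hmu) subee.
rewrite -(@ge0_integral_image _ _ _ _ _ mu P fst u) //.
- rewrite (@ge0_negligible_integral _ _ _ mu setT (~` E)) ?setTD ?setCK//.
  by apply: measurableT_comp => //; exact: measurable_fst.
- by move=> A mA; rewrite -setXT; exact: (invariant_marginal hmu).
Qed.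

(** [f n] itself need not be integrable; its integral may be [-oo]. *)
Lemma integral_f n : (0 < n)%N ->
  (\int[mu]_(p in E) (f n p)%:E =
   (n%:R * mean_bound)%:E - \int[mu]_(p in E) (deficit n p)%:E)%E.
Proof.
move=> n0.
have mob : measurable_fun setT (EFin \o orbit_bound n).
  exact/measurable_EFinP/measurable_orbit_bound.
have ob0 w : (0 <= (EFin \o orbit_bound n) w)%E by rewrite lee_fin orbit_bound_ge0.
have obE := integral_marginal mob ob0.
rewrite -integral_orbit_bound -[X in (X - _)%E]obE.
rewrite -integral_sub_ge0//.
- apply: eq_integral => p _; rewrite -EFinB /deficit; congr EFin; ring.
- apply/integrableP; split.
    apply/measurable_EFinP; apply: measurable_funTS.
    apply: measurableT_comp; [exact: measurable_orbit_bound|exact: measurable_fst].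
  under eq_integral => p _ do rewrite /= ger0_norm ?orbit_bound_ge0//.
  by rewrite [X in (X < _)%E]obE /= integral_orbit_bound ltry.
- by apply/measurable_EFinP; have [] := deficit_measurable_continuous n0.
- by move=> p Ep; rewrite lee_fin deficit_ge0.
Qed.

Lemma integral_deficit_ge n : (0 < n)%N ->
  (\int[P]_w min_deficit n w <= \int[mu]_(p in E) (deficit n p)%:E)%E.
Proof.
move=> n0; rewrite -integral_marginal.
- by apply: le_integral_pointwise => -[w x] Ex; exact: fiber_inf_le.
- exact: measurable_min_deficit.
- by move=> w; exact: min_deficit_ge0.
Qed.

Lemma Phi_star_eqNy : ~ recurrent_deficit -> Phi_star E f mu = -oo%E.
Proof.
move=> nrec; apply: cvg_lim => //; apply/cvgeNyPle => A.
apply: filterS (not_recurrent_deficit (mean_bound - A) nrec) => n [n0 intn].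
have nR : 0 < n%:R :> R by rewrite ltr0n.
rewrite lee_pdivrMl// integral_f//.
apply: le_trans (leeB (lexx _) (le_trans (ltW intn) (integral_deficit_ge n0))) _.
by rewrite -EFinB -EFinM lee_fin -mulrBr ler_pM2l//; lra.
Qed.

Lemma Phi_star_neqNy (C : R) :
  (forall n, (0 < n)%N ->
     (\int[mu]_(p in E) (deficit n p)%:E <= (n%:R * C)%:E)%E) ->
  Phi_star E f mu <> -oo%E.
Proof.
move=> HC; apply: (@lim_neq_Ny _ _ _ _ _ (mean_bound - C)).
exists 1%N => // n /= n0; have nR : 0 < n%:R :> R by rewrite ltr0n.
rewrite lee_pdivlMl// integral_f//.
apply: le_trans (leeB (lexx _) (HC n n0)).
by rewrite -EFinB -EFinM lee_fin -mulrBr.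
Qed.

End invariant.

Lemma recurrent_deficit_measure : recurrent_deficit ->
  exists mu : probability Y R,
    invariant_measure P theta E T mu /\ Phi_star E f mu <> -oo%E.
Proof.
move=> [C HC].
have [mu [hmu intmu]] := superadditive_invariant_measure cP cX mtheta Ptheta hT
  deficit_measurable_continuous deficit_ge0 deficit_superadditive HC.
exists mu; split=> //; exact: Phi_star_neqNy intmu.
Qed.

End reduction.

Theorem mainTheorem2 (R : realType) (d : measure_display)
  (Omega : measurableType d) (P : probability Omega R) (theta : Omega -> Omega)
  (X : pointedMetricType R) (E : set (Omega * borel X)) (T : Omega -> X -> X)
  (f : nat -> Omega * borel X -> R)
  (hbase : base_system P theta)
  (hX : compact [set: X])
  (hT : bundle_RDS P theta E T)
  (hsub : subadditive_sequence theta E T f)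
  (hf1 : L1_continuous P E (f 1%N))
  (hf : forall n, (0 < n)%N -> measurable_continuous E (f n)) :
  pressure P theta E T f = -oo%E <->
  (forall mu : probability (Omega * borel X)%type R,
     invariant_measure P theta E T mu -> Phi_star E f mu = -oo%E).
Proof.
have cP := base_complete hbase.
have [_ [mtheta _ _ _]] := base_invertible hbase.
have Ptheta := base_preserves hbase.
rewrite (pressure_eqNy cP mtheta Ptheta hX hT hsub hf1 hf).
split=> [nrec mu hmu|allNy rec].
  exact: (Phi_star_eqNy cP mtheta Ptheta hX hT hsub hf1 hf hmu nrec).
have [mu [hmu]] :=
  recurrent_deficit_measure cP mtheta Ptheta hX hT hsub hf1 hf rec.
by apply; exact: allNy.
Qed.
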